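(* Suppose that $\varphi_\alpha(z) = z_1^2 + \alpha z_1 z_2 + z_2^2$ for $\alpha\geq 0$. Then \[\|\varphi_\alpha\|_{W(\mathbb{T}^2)} = \begin{cases} \sqrt{2+\alpha^2}, & \text{if } 0 \leq \alpha \leq 1/2; \\ \frac{4+\alpha}{3}, & \text{if } 1/2 < \alpha \leq 2; \\ \alpha, & \text{if } \alpha>2. \end{cases}\]
   Context: $\mathbb{T}$ is the unit circle in the complex plane, and $\mathbb{T}^2$ carries the product of normalized Lebesgue arc length measures. The Hardy space $H^2(\mathbb{T}^2)$ is the closure in $L^2(\mathbb{T}^2)$ of the set of polynomials in two complex variables, with the $L^2$ norm; its elements are identified in the usual way with their holomorphic extensions to the polydisc $\mathbb{D}^2$. The weak product space $W(\mathbb{T}^2) = H^2(\mathbb{T}^2)\odot H^2(\mathbb{T}^2)$ is the Banach space of all functions $f$ (on $\mathbb{D}^2$) that have a weak factorization $f = \sum_{j=1}^\infty g_j h_j$ with $g_j,h_j$ in $H^2(\mathbb{T}^2)$ and $\sum_{j=1}^\infty \|g_j\|_{H^2(\mathbb{T}^2)}\|h_j\|_{H^2(\mathbb{T}^2)}<\infty$; its norm $\|f\|_{W(\mathbb{T}^2)}$ is the infimum of the latter sum over all weak factorizations of $f$. *)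

(* Defs.v *)
From HB Require Import structures.
From mathcomp Require Import all_boot all_order all_algebra.
From mathcomp Require Import complex.
From mathcomp Require Import all_classical all_reals all_analysis.

Set Implicit Arguments.
Unset Strict Implicit.
Unset Printing Implicit Defensive.

Import Order.TTheory GRing.Theory Num.Theory.
Import numFieldNormedType.Exports.

Local Open Scope classical_set_scope.
Local Open Scope ring_scope.
Local Open Scope complex_scope.

Lemma two_pi_gt0 (R : realType) : 0 < 2 * pi :> R.
Proof. by rewrite mulr_gt0// pi_gt0. Qed.

(* The torus is parametrized by its angles: if (s, t) is distributed according
   to the product of two uniform laws on [0, 2 pi], then (e^{is}, e^{it}) is
   distributed according to the product of two normalized arc length measures. *)
Definition torus_measure (R : realType) :=
  (uniform_prob (two_pi_gt0 R) \x uniform_prob (two_pi_gt0 R))%E.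

Definition torus_point (R : realType) (t : R * R) : R[i] * R[i] :=
  (cos t.1 +i* sin t.1, cos t.2 +i* sin t.2).

(* Functions on the torus are represented by functions on R[i] * R[i]; the
   notions below only depend on their values on the torus, and (for measurable
   functions) only up to equality almost everywhere. *)
Definition torus_measurable (R : realType) (f : R[i] * R[i] -> R[i]) : Prop :=
  measurable_fun [set: R * R] (fun t => complex.Re (f (torus_point t))) /\
  measurable_fun [set: R * R] (fun t => complex.Im (f (torus_point t))).

Definition L2norm (R : realType) (f : R[i] * R[i] -> R[i]) : \bar R :=
  Lnorm (@torus_measure R) 2%:E
    (fun t => (Normc.normc (f (torus_point t)))%:E).

Definition L2 (R : realType) (f : R[i] * R[i] -> R[i]) : Prop :=
  torus_measurable f /\ (L2norm f < +oo)%E.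

Definition poly2_fun (R : realType) (p : {poly {poly R[i]}}) :
  R[i] * R[i] -> R[i] := fun z => p.[z.1%:P].[z.2].

Definition H2 (R : realType) (f : R[i] * R[i] -> R[i]) : Prop :=
  L2 f /\
  forall e : R, 0 < e ->
    exists p : {poly {poly R[i]}},
      (L2norm (fun z => (f z - poly2_fun p z)%R) < e%:E)%E.

Definition torus_integral (R : realType) (f : R[i] * R[i] -> R[i]) : R[i] :=
  Rintegral (@torus_measure R) setT (fun t => complex.Re (f (torus_point t))) +i*
  Rintegral (@torus_measure R) setT (fun t => complex.Im (f (torus_point t))).

Definition fourier_coef (R : realType) (f : R[i] * R[i] -> R[i]) (m n : nat) :
  R[i] := torus_integral (fun z => f z * (z.1 ^+ m * z.2 ^+ n)^*).

(* The holomorphic extension of f in H2 to the polydisc is the power series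
   whose coefficients are the Fourier coefficients of f; it converges
   absolutely at every point of the polydisc. *)
Definition hol_ext (R : realType) (f : R[i] * R[i] -> R[i])
    (z : R[i] * R[i]) : R[i] :=
  limn (fun N : nat =>
    \sum_(m < N) \sum_(n < N) fourier_coef f m n * z.1 ^+ m * z.2 ^+ n : R[i]^o).

Definition polydisc (R : realType) : set (R[i] * R[i]) :=
  [set z | `|z.1| < 1 /\ `|z.2| < 1].

Definition factor_cost (R : realType) (g h : nat -> R[i] * R[i] -> R[i]) :
  \bar R := (\sum_(0 <= j <oo) (L2norm (g j) * L2norm (h j)))%E.

Definition weak_factorization (R : realType) (f : R[i] * R[i] -> R[i])
    (g h : nat -> R[i] * R[i] -> R[i]) : Prop :=
  [/\ forall j, H2 (g j),
      forall j, H2 (h j),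
      (factor_cost g h < +oo)%E &
      forall z, polydisc z ->
        (series (fun j => hol_ext (g j) z * hol_ext (h j) z : R[i]^o)
           @ \oo --> (f z : R[i]^o))].

(* The value is +oo exactly when f is not in the weak product space. *)
Definition Wnorm (R : realType) (f : R[i] * R[i] -> R[i]) : \bar R :=
  ereal_inf [set c | exists g h, weak_factorization f g h /\ c = factor_cost g h].

Definition phi (R : realType) (alpha : R) (z : R[i] * R[i]) : R[i] :=
  z.1 ^+ 2 + alpha%:C * z.1 * z.2 + z.2 ^+ 2.

(* Main.v *)
Require Import Defs.
From mathcomp Require Import all_boot all_order all_algebra.
From mathcomp Require Import complex.
From mathcomp Require Import all_classical all_reals all_analysis.
From mathcomp Require Import measurable_realfun.
From mathcomp Require Import ring lra.

Set Implicit Arguments.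
Unset Strict Implicit.
Unset Printing Implicit Defensive.

Import Order.TTheory GRing.Theory Num.Theory.
Import numFieldNormedType.Exports.
Local Open Scope ring_scope.
Local Open Scope classical_set_scope.
Local Open Scope complex_scope.

(** The norm is computed by duality. For reals [a, b >= 0] let [L] be the
    functional that sends a power series [f] with Taylor coefficients [f_mn] to
    [a (f_20 + f_02) + b f_11]. On a product [g h] it only sees the
    coefficients of [g] and [h] of degree at most two, and it splits by degree:
    [g_00] meets the degree two part of [h] through the row [(a, b, a)], the
    degree two part of [g] meets [h_00] in the same way, and the two degree one
    parts meet through the symmetric matrix with rows [(a, b)] and [(b, a)].
    These blocks have operator norms [sqrt (2 a^2 + b^2)] and [a + b]; when
    both are at most one, Cauchy-Schwarz and Bessel's inequality give
    [|L (g h)| <= |g| |h|] ([degree2_form_le]), and therefore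
    [L phi_alpha = 2 a + b alpha] is at most the cost of any weak
    factorization. The optimal pairs are [(1, alpha)] divided by
    [sqrt (2 + alpha^2)], for which the row has norm one, as long as
    [alpha <= 1/2] keeps the sum below one; [(2/3, 1/3)], where both
    constraints are tight; and [(0, 1)] for [alpha > 2].

    These values are attained. The trivial factorization [phi_alpha * 1] costs
    [sqrt (2 + alpha^2)], and [(z1 + z2)^2 + (alpha - 2) z1 * z2] costs
    [alpha] once [alpha >= 2]. Between [1/2] and [2], [phi_alpha] is a convex
    combination of [phi_(1/2) * 1] and [phi_2 = (z1 + z2)^2], which have costs
    [3/2] and [2].

    A weak factorization only converges pointwise on the polydisc, so [L] has
    to be read off from values. The functional [degree2_test] combines second
    differences at five points at scale [t]; on [phi_alpha] it is exactly
    [4 t^2 (2 a + b alpha)], and on a product of extensions it is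
    [4 t^2 L (g h)] up to an error [O(t^3) |g| |h|] that is uniform in [g] and
    [h] ([degree2_test_mul_le]), because the Taylor coefficients are bounded by
    the norm. Summing over the factorization, dividing by [t^2] and letting [t]
    tend to zero gives [weak_factorization_cost_ge].

    Everything rests on the orthonormality of the monomials on the torus
    ([inner_monomial]), which yields Bessel's inequality for the lower bound
    and the norms and extensions of polynomials for the upper bound. *)

(** * Integrals of trigonometric waves over the torus *)

Section TorusIntegral.
Variable R : realType.

Lemma sin_cos_winding (m n : nat) (th : R) :
  sin ((m%:R - n%:R) * (2 * pi) + th) = sin th.
Proof.
have -> : (m%:R - n%:R) * (2 * pi) + th = th + pi *+ 2 *+ m - pi *+ 2 *+ n :> R.
  by rewrite -[pi *+ 2 *+ m]mulr_natr -[pi *+ 2 *+ n]mulr_natr -mulr_natr; ring.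
rewrite -(periodicn (@sinD2pi R) n) subrK.
exact: (periodicn (@sinD2pi R) m).
Qed.

Lemma continuous_cos_affine (a th : R) :
  continuous (fun x : R => 1 + cos (a * x + th)).
Proof.
move=> x; apply: cvgD; first exact: cvg_cst.
apply: (@continuous_comp _ _ _ (fun x => a * x + th) cos); last exact: continuous_cos.
by apply: cvgD; [apply: cvgM; [exact: cvg_cst|exact: cvg_id]|exact: cvg_cst].
Qed.

(** Adding [1] makes the integrand nonnegative, so that the change to Lebesgue
    measure here, and Tonelli's theorem below, need no integrability. The
    frequency is kept as a difference of naturals because it arises from a
    monomial times the conjugate of another; the phase turns sines into
    cosines. *)
Lemma integral_cos_affine (m n : nat) (th : R) : m != n ->
  (\int[uniform_prob (two_pi_gt0 R)]_x (1 + cos ((m%:R - n%:R) * x + th))%:E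
    = 1)%E.
Proof.
move=> mn; set a : R := m%:R - n%:R.
have a0 : a != 0 by rewrite subr_eq0 eqr_nat.
rewrite integral_uniform; last 2 first.
- apply/measurable_EFinP; apply: continuous_measurable_fun.
  exact: continuous_cos_affine.
- by move=> x; rewrite lee_fin; have := cos_geN1 (a * x + th); lra.
pose F : R^o -> R^o := fun x => x + a^-1 * sin (a * x + th).
have dF (x : R^o) : is_derive x (1 : R^o) F (1 + cos (a * x + th)).
  apply: is_derive_eq.
  by rewrite /GRing.scale/= addr0 mulr1 mulrCA mulVf// mulr1.
have -> : (\int[lebesgue_measure]_(x in `[0%R, (2 * pi)%R])
    (1 + cos (a * x + th))%:E = (F (2 * pi))%:E - (F 0)%:E)%E; last first.
  rewrite -EFinD -EFinM /F sin_cos_winding; congr EFin.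
  by rewrite mulr0 !add0r subr0 addrK mulVf// gt_eqF// two_pi_gt0.
apply: (@continuous_FTC2 R (fun x => 1 + cos (a * x + th)) F).
- exact: two_pi_gt0.
- by apply: continuous_subspaceT; exact: continuous_cos_affine.
- have cF x : {for x, continuous F}.
    by apply/differentiable_continuous/derivable1_diffP; exact: ex_derive.
  split; first by move=> x _; exact: ex_derive.
  + by apply: cvg_at_right_filter; exact: cF.
  + by apply: cvg_at_left_filter; exact: cF.
- by move=> x _; rewrite derive1E derive_val.
Qed.

Local Notation T := (@torus_measure R).

Lemma torus_measure_setT : T setT = 1%E.
Proof.
have -> : [set: R * R] = [set: R] `*` [set: R] by rewrite setXTT.
rewrite /torus_measure product_measure1E//.
transitivity (1 * 1 : \bar R)%E; last by rewrite mule1.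
by congr (_ * _)%E; exact: probability_setT.
Qed.

Lemma measurable_torus_wave (a b th : R) :
  measurable_fun [set: R * R] (fun t => cos (a * t.1 + b * t.2 + th)).
Proof.
apply: measurableT_comp.
  by apply: continuous_measurable_fun; exact: continuous_cos.
apply: measurable_funD => //; apply: measurable_funD.
- by apply: measurable_funM => //; exact: measurable_fst.
- by apply: measurable_funM => //; exact: measurable_snd.
Qed.

(** Integrate first in a variable whose frequency is nonzero: by
    [integral_cos_affine] the inner integral is already constant. *)
Lemma integral_torus_wave (m p n q : nat) (th : R) :
  ~~ ((m == p) && (n == q)) ->
  (\int[T]_t (1 + cos ((m%:R - p%:R) * t.1 + (n%:R - q%:R) * t.2 + th))%:E
    = 1)%E.
Proof.
move=> mpnq; set f := (fun t : R * R => _).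
have mf : measurable_fun setT f.
  apply/measurable_EFinP; apply: measurable_funD => //.
  exact: measurable_torus_wave.
have f0 t : (0 <= f t)%E.
  rewrite lee_fin.
  by have := cos_geN1 ((m%:R - p%:R) * t.1 + (n%:R - q%:R) * t.2 + th); lra.
have int1 : (\int[uniform_prob (two_pi_gt0 R)]_x 1 = 1)%E.
  rewrite integral_cst// mul1e; exact: probability_setT.
have [nq|nq] := eqVneq n q.
  have mp : m != p by move: mpnq; rewrite nq eqxx andbT.
  rewrite /torus_measure fubini_tonelli2//= /fubini_G.
  rewrite -[RHS]int1; apply: eq_integral => y _.
  rewrite -[RHS](integral_cos_affine ((n%:R - q%:R) * y + th) mp).
  by apply: eq_integral => x _; rewrite /f/= addrA.
rewrite /torus_measure fubini_tonelli1//= /fubini_F.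
rewrite -[RHS]int1; apply: eq_integral => x _.
rewrite -[RHS](integral_cos_affine ((m%:R - p%:R) * x + th) nq).
by apply: eq_integral => y _; rewrite /f/= addrA [_ * y + _]addrC.
Qed.

Lemma bounded_torus_integrable (u : R * R -> R) (M : R) :
  measurable_fun setT u -> (forall t, `|u t| <= M) ->
  T.-integrable setT (EFin \o u).
Proof.
move=> mu uM; apply: measurable_bounded_integrable => //.
  by have := ltry (1 : R); rewrite -torus_measure_setT.
exists M; split; first exact: num_real.
by move=> x Mx t _ /=; exact: le_trans (uM t) (ltW Mx).
Qed.

Lemma Rintegral_torus_cst (c : R) : (\int[T]_t c = c)%R.
Proof.
rewrite Rintegral_cst// (_ : fine _ = 1) ?mulr1//.
exact: (congr1 fine torus_measure_setT).
Qed.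

Lemma Rintegral_torus_wave (m p n q : nat) (th : R) :
  ~~ ((m == p) && (n == q)) ->
  (\int[T]_t cos ((m%:R - p%:R) * t.1 + (n%:R - q%:R) * t.2 + th) = 0)%R.
Proof.
move=> mpnq; set u := (fun t : R * R => _).
have iu : T.-integrable setT (EFin \o u).
  by apply: (@bounded_torus_integrable _ 1) => [|t];
    [exact: measurable_torus_wave|exact: cos_max].
have := integral_torus_wave th mpnq => /(congr1 fine)/=.
rewrite -[LHS]/(Rintegral T setT (fun t => 1 + u t)) RintegralD//; last first.
  by apply: (@bounded_torus_integrable _ 1) => // t; rewrite normr1.
rewrite Rintegral_torus_cst; lra.
Qed.

(** * Complex integrals, square integrable functions and Bessel's inequality *)

Implicit Types (f g : R[i] * R[i] -> R[i]).

Definition torus_integrable f : Prop :=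
  T.-integrable setT (EFin \o (fun t => complex.Re (f (torus_point t)))) /\
  T.-integrable setT (EFin \o (fun t => complex.Im (f (torus_point t)))).

Lemma torus_integralD f g : torus_integrable f -> torus_integrable g ->
  torus_integral (fun z => f z + g z) = torus_integral f + torus_integral g.
Proof.
move=> [fr fi] [gr gi]; rewrite /torus_integral.
transitivity (Complex
    (\int[T]_t (complex.Re (f (torus_point t)) + complex.Re (g (torus_point t))))%R
    (\int[T]_t (complex.Im (f (torus_point t)) + complex.Im (g (torus_point t))))%R).
  by congr Complex; congr Rintegral; apply/funext => t;
    case: (f _) => ? ?; case: (g _).
by rewrite RintegralD// RintegralD.
Qed.

Lemma torus_integrableD f g : torus_integrable f -> torus_integrable g ->
  torus_integrable (fun z => f z + g z).
Proof.
move=> [fr fi] [gr gi]; split.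
- rewrite [X in _.-integrable _ X](_ : _ =
    (EFin \o (fun t => complex.Re (f (torus_point t)))) \+
    (EFin \o (fun t => complex.Re (g (torus_point t)))))%E; first exact: integrableD.
  by apply/funext => t /=; case: (f _) => ? ?; case: (g _).
- rewrite [X in _.-integrable _ X](_ : _ =
    (EFin \o (fun t => complex.Im (f (torus_point t)))) \+
    (EFin \o (fun t => complex.Im (g (torus_point t)))))%E; first exact: integrableD.
  by apply/funext => t /=; case: (f _) => ? ?; case: (g _).
Qed.

Lemma integrable_lincomb (u v : R * R -> R) (a b : R) :
  T.-integrable setT (EFin \o u) -> T.-integrable setT (EFin \o v) ->
  T.-integrable setT (EFin \o (fun t => a * u t + b * v t)).
Proof.
move=> iu iv.
rewrite [X in _.-integrable _ X](_ : _ =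
    (fun t => a%:E * (EFin \o u) t) \+ (fun t => b%:E * (EFin \o v) t))%E.
  by apply: integrableD => //; apply: integrableZl.
by apply/funext => t /=; rewrite EFinD !EFinM.
Qed.

Lemma Rintegral_lincomb (u v : R * R -> R) (a b : R) :
  T.-integrable setT (EFin \o u) -> T.-integrable setT (EFin \o v) ->
  (\int[T]_t (a * u t + b * v t) = a * \int[T]_t u t + b * \int[T]_t v t)%R.
Proof.
move=> iu iv; rewrite RintegralD//; first by rewrite RintegralZl// RintegralZl.
- have := integrableZl measurableT a iu.
  by congr (_.-integrable _ _); apply/funext => t /=; rewrite EFinM.
- have := integrableZl measurableT b iv.
  by congr (_.-integrable _ _); apply/funext => t /=; rewrite EFinM.
Qed.

Lemma torus_integrableZ (c : R[i]) f : torus_integrable f ->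
  torus_integrable (fun z => c * f z).
Proof.
case: c => a b [fr fi]; split.
- have := integrable_lincomb a (- b) fr fi.
  congr (_.-integrable _ _); apply/funext => t /=.
  by case: (f _) => u v /=; rewrite mulNr.
- have := integrable_lincomb a b fi fr.
  congr (_.-integrable _ _); apply/funext => t /=.
  by case: (f _) => u v /=; rewrite [b * _]mulrC.
Qed.

Lemma torus_integralZ (c : R[i]) f : torus_integrable f ->
  torus_integral (fun z => c * f z) = c * torus_integral f.
Proof.
case: c => a b [fr fi]; rewrite /torus_integral.
transitivity (Complex
    (\int[T]_t (a * complex.Re (f (torus_point t)) +
                - b * complex.Im (f (torus_point t))))%R
    (\int[T]_t (a * complex.Im (f (torus_point t)) +
                b * complex.Re (f (torus_point t))))%R).
  congr Complex; congr Rintegral; apply/funext => t; case: (f _) => u v /=; ring.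
rewrite Rintegral_lincomb// Rintegral_lincomb//.
by apply/eqP; rewrite eq_complex /=; apply/andP; split; apply/eqP; ring.
Qed.

Lemma torus_integralJ f : torus_integrable f ->
  torus_integral (fun z => (f z)^*) = (torus_integral f)^*.
Proof.
move=> [fr fi]; rewrite /torus_integral /=; congr Complex.
  by congr Rintegral; apply/funext => t; case: (f _).
rewrite -mulN1r -RintegralZl//; congr Rintegral; apply/funext => t.
by case: (f _) => u v /=; rewrite mulN1r.
Qed.

Lemma torus_integrable_cst0 : torus_integrable (fun=> 0).
Proof.
by split; apply: (@bounded_torus_integrable _ 0) => // t; rewrite normr0.
Qed.

Lemma torus_integral_cst0 : torus_integral (fun=> 0 : R[i]) = 0 :> R[i].
Proof. by rewrite /torus_integral /= Rintegral_torus_cst. Qed.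

Lemma torus_integrable_sum (I : Type) (s : seq I)
    (F : I -> R[i] * R[i] -> R[i]) :
  (forall i, torus_integrable (F i)) ->
  torus_integrable (fun z => \sum_(i <- s) F i z).
Proof.
move=> iF; elim: s => [|i s ih].
  have := torus_integrable_cst0.
  by congr torus_integrable; apply/funext => z; rewrite big_nil.
have := torus_integrableD (iF i) ih.
by congr torus_integrable; apply/funext => z; rewrite big_cons.
Qed.

Lemma torus_integral_sum (I : Type) (s : seq I) (F : I -> R[i] * R[i] -> R[i]) :
  (forall i, torus_integrable (F i)) ->
  torus_integral (fun z => \sum_(i <- s) F i z) =
  \sum_(i <- s) torus_integral (F i).
Proof.
move=> iF; elim: s => [|i s ih].
  rewrite big_nil -[RHS]torus_integral_cst0; congr torus_integral.
  by apply/funext => z; rewrite big_nil.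
rewrite big_cons -ih -torus_integralD//; last exact: torus_integrable_sum.
by congr torus_integral; apply/funext => z; rewrite big_cons.
Qed.

Definition abs2 (z : R[i]) : R := complex.Re z ^+ 2 + complex.Im z ^+ 2.

Lemma abs2_ge0 z : 0 <= abs2 z.
Proof. by rewrite addr_ge0// sqr_ge0. Qed.

Lemma mulcJ_abs2 z : z * z^* = (abs2 z)%:C.
Proof.
case: z => u v; apply/eqP; rewrite eq_complex /abs2 /=.
by apply/andP; split; apply/eqP; ring.
Qed.

Lemma abs2M (z w : R[i]) : abs2 (z * w) = abs2 z * abs2 w.
Proof. by case: z w => a b [c d]; rewrite /abs2 /=; ring. Qed.

Lemma measurable_abs2 f : torus_measurable f ->
  measurable_fun setT (fun t => abs2 (f (torus_point t))).
Proof.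
move=> [mr mi]; apply: measurable_funD; exact: measurable_funX.
Qed.

Lemma L2norm_integral f : L2norm f =
  ((\int[T]_t (abs2 (f (torus_point t)))%:E) `^ 2^-1)%E.
Proof.
rewrite /L2norm unlock; congr (_ `^ _)%E; apply: eq_integral => t _.
rewrite /= (_ : Normc.normc _ = Num.sqrt (abs2 (f (torus_point t)))).
  by rewrite ger0_norm ?sqrtr_ge0// powR_mulrn ?sqrtr_ge0// sqr_sqrtr ?abs2_ge0.
by case: (f _).
Qed.

(** Equivalent to [L2], but with a real integral in place of [Lnorm], on which
    the linear theory of the integral acts directly. *)
Definition square_integrable f : Prop :=
  torus_measurable f /\
  T.-integrable setT (EFin \o (fun t => abs2 (f (torus_point t)))).

Lemma L2_square_integrable f : L2 f -> square_integrable f.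
Proof.
move=> [mf]; rewrite L2norm_integral => foo; split => //.
apply/integrableP; split.
  by apply/measurable_EFinP; exact: measurable_abs2.
under eq_integral do rewrite /= ger0_norm ?abs2_ge0//.
rewrite ltey; apply: contraTneq foo => ->.
by rewrite poweRyr ?invr_eq0// ltxx.
Qed.

Lemma L2normE f : square_integrable f ->
  L2norm f = (Num.sqrt (\int[T]_t abs2 (f (torus_point t)))%R)%:E.
Proof.
move=> [mf sf]; rewrite L2norm_integral.
rewrite -[X in (X `^ _)%E]fineK; last exact: integrable_fin_num.
rewrite poweR_EFin powR12_sqrt// fine_ge0// integral_ge0// => t _.
by rewrite lee_fin abs2_ge0.
Qed.

Lemma square_integrable_L2 f : square_integrable f -> L2 f.
Proof. by move=> sf; split; [exact: sf.1|rewrite L2normE// ltry]. Qed.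

Definition inner f g : R[i] := torus_integral (fun z => f z * (g z)^*).

(** [|Re (z w)|] and [|Im (z w)|] are at most [|z|^2 + |w|^2]. *)
Lemma inner_integrable f g : square_integrable f -> square_integrable g ->
  torus_integrable (fun z => f z * (g z)^*).
Proof.
move=> [[mfr mfi] sf] [[mgr mgi] sg].
have sfg := integrable_lincomb 1 1 sf sg.
have xy (a b c d : R) : `|a * b + c * d| <= a ^+ 2 + c ^+ 2 + (b ^+ 2 + d ^+ 2).
  rewrite ler_norml; apply/andP; split.
    have := sqr_ge0 (a + b); have := sqr_ge0 (c + d).
    have := sqr_ge0 a; have := sqr_ge0 b; have := sqr_ge0 c; have := sqr_ge0 d.
    by rewrite !sqrrD; lra.
  have := sqr_ge0 (a - b); have := sqr_ge0 (c - d).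
  have := sqr_ge0 a; have := sqr_ge0 b; have := sqr_ge0 c; have := sqr_ge0 d.
  by rewrite !sqrrB; lra.
split; apply: (le_integrable _ _ _ sfg) => //.
- apply/measurable_EFinP.
  have : measurable_fun setT (fun t =>
      complex.Re (f (torus_point t)) * complex.Re (g (torus_point t)) +
      complex.Im (f (torus_point t)) * complex.Im (g (torus_point t))).
    by apply: measurable_funD; exact: measurable_funM.
  congr measurable_fun; apply/funext => t /=.
  by case: (f _) => a b; case: (g _) => c d /=; ring.
- move=> t _; rewrite /abs2 /= !mul1r lee_fin; case: (f _) => a b; case: (g _) => c d /=.
  rewrite [leRHS]ger0_norm ?addr_ge0 ?sqr_ge0//.
  by apply: le_trans (xy a c b d); rewrite mulrN opprK.
- apply/measurable_EFinP.
  have : measurable_fun setT (fun t =>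
      complex.Im (f (torus_point t)) * complex.Re (g (torus_point t)) -
      complex.Re (f (torus_point t)) * complex.Im (g (torus_point t))).
    by apply: measurable_funB; exact: measurable_funM.
  congr measurable_fun; apply/funext => t /=.
  by case: (f _) => a b; case: (g _) => c d /=; ring.
- move=> t _; rewrite /abs2 /= !mul1r lee_fin; case: (f _) => a b; case: (g _) => c d /=.
  rewrite [leRHS]ger0_norm ?addr_ge0 ?sqr_ge0//.
  apply: le_trans (_ : `|a * (- d) + b * c| <= _); first by rewrite mulrN.
  by apply: le_trans (xy _ _ _ _) _; rewrite sqrrN [d ^+ 2 + _]addrC.
Qed.

Lemma abs2D_le (z w : R[i]) : abs2 (z + w) <= 2 * abs2 z + 2 * abs2 w.
Proof.
case: z w => a b [c d]; rewrite /abs2 /= -subr_ge0.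
rewrite (_ : _ - _ = (a - c) ^+ 2 + (b - d) ^+ 2); last by ring.
by rewrite addr_ge0// sqr_ge0.
Qed.

Lemma square_integrable_le f (u : R * R -> R) : torus_measurable f ->
  T.-integrable setT (EFin \o u) ->
  (forall t, abs2 (f (torus_point t)) <= u t) -> square_integrable f.
Proof.
move=> mf iu fu; split => //; apply: (le_integrable _ _ _ iu) => //.
  by apply/measurable_EFinP; exact: measurable_abs2.
move=> t _ /=; rewrite lee_fin ger0_norm ?abs2_ge0//.
exact: le_trans (fu t) (ler_norm _).
Qed.

Lemma torus_measurableD f g : torus_measurable f -> torus_measurable g ->
  torus_measurable (fun z => f z + g z).
Proof.
move=> [fr fi] [gr gi]; split.
- have := measurable_funD fr gr; congr measurable_fun.
  by apply/funext => t /=; case: (f _) => ? ?; case: (g _).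
- have := measurable_funD fi gi; congr measurable_fun.
  by apply/funext => t /=; case: (f _) => ? ?; case: (g _).
Qed.

Lemma torus_measurable_cst (c : R[i]) : torus_measurable (fun=> c).
Proof. by split; exact: measurable_cst. Qed.

Lemma torus_measurableM f g : torus_measurable f -> torus_measurable g ->
  torus_measurable (fun z => f z * g z).
Proof.
move=> [fr fi] [gr gi]; split.
- have := measurable_funB (measurable_funM fr gr) (measurable_funM fi gi).
  congr measurable_fun.
  by apply/funext => t /=; case: (f _) => ? ?; case: (g _).
- have := measurable_funD (measurable_funM fr gi) (measurable_funM fi gr).
  congr measurable_fun.
  by apply/funext => t /=; case: (f _) => ? ?; case: (g _).
Qed.

Lemma square_integrableD f g : square_integrable f -> square_integrable g ->
  square_integrable (fun z => f z + g z).
Proof.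
move=> [mf sf] [mg sg].
apply: (square_integrable_le (torus_measurableD mf mg)
  (integrable_lincomb 2 2 sf sg)) => t.
exact: abs2D_le.
Qed.

Lemma square_integrableZ (c : R[i]) f : square_integrable f ->
  square_integrable (fun z => c * f z).
Proof.
move=> [mf sf].
apply: (square_integrable_le (torus_measurableM (torus_measurable_cst c) mf)
  (integrable_lincomb (abs2 c) 0 sf sf)) => t.
by rewrite abs2M mul0r addr0.
Qed.

Lemma square_integrable_cst0 : square_integrable (fun=> 0).
Proof.
apply: (@square_integrable_le _ (fun=> 0)); first exact: torus_measurable_cst.
  by apply: (@bounded_torus_integrable _ 0) => // t; rewrite normr0.
by move=> t; rewrite /abs2 /= expr0n addr0.
Qed.

Lemma square_integrable_sum (I : Type) (s : seq I)
    (F : I -> R[i] * R[i] -> R[i]) :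
  (forall i, square_integrable (F i)) ->
  square_integrable (fun z => \sum_(i <- s) F i z).
Proof.
move=> iF; elim: s => [|i s ih].
  have := square_integrable_cst0.
  by congr square_integrable; apply/funext => z; rewrite big_nil.
have := square_integrableD (iF i) ih.
by congr square_integrable; apply/funext => z; rewrite big_cons.
Qed.

Lemma innerC f g : square_integrable f -> square_integrable g ->
  inner g f = (inner f g)^*.
Proof.
move=> sf sg; rewrite /inner -torus_integralJ; last exact: inner_integrable.
by congr torus_integral; apply/funext => z; rewrite rmorphM /= conjcK mulrC.
Qed.

Lemma innerBl f g h : square_integrable f -> square_integrable g ->
  square_integrable h ->
  inner (fun z => f z - g z) h = inner f h - inner g h.
Proof.
move=> sf sg sh; have ifh := inner_integrable sf sh.
have igh := inner_integrable sg sh.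
rewrite -[- inner g h]mulN1r -torus_integralZ// -torus_integralD//; last first.
  exact: torus_integrableZ.
by congr torus_integral; apply/funext => z; rewrite mulN1r mulrBl.
Qed.

Lemma inner_suml (I : finType) (c : I -> R[i]) (e : I -> R[i] * R[i] -> R[i]) h :
  (forall i, square_integrable (e i)) -> square_integrable h ->
  inner (fun z => \sum_i c i * e i z) h = \sum_i c i * inner (e i) h.
Proof.
move=> se sh; have ieh i := inner_integrable (se i) sh.
under eq_bigr do rewrite -torus_integralZ//.
rewrite -torus_integral_sum; last by move=> i; exact: torus_integrableZ.
congr torus_integral; apply/funext => z; rewrite mulr_suml.
by apply: eq_bigr => i _; rewrite mulrA.
Qed.

Lemma inner_self f : inner f f = (\int[T]_t abs2 (f (torus_point t)))%R%:C.
Proof.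
rewrite /inner /torus_integral; congr Complex.
  by congr Rintegral; apply/funext => t; rewrite mulcJ_abs2.
rewrite -[RHS]Rintegral_torus_cst; congr Rintegral.
by apply/funext => t; rewrite mulcJ_abs2.
Qed.

Definition orthonormal_family (I : finType) (e : I -> R[i] * R[i] -> R[i]) :=
  (forall i, square_integrable (e i)) /\
  (forall i j, inner (e i) (e j) = (i == j)%:R).

Lemma inner_orthonormal (I : finType) (e : I -> R[i] * R[i] -> R[i])
    (c : I -> R[i]) j : orthonormal_family e ->
  inner (fun z => \sum_i c i * e i z) (e j) = c j.
Proof.
move=> [se oe]; rewrite inner_suml// (bigD1 j)//= oe eqxx mulr1 big1 ?addr0//.
by move=> i /negbTE ij; rewrite oe ij mulr0.
Qed.

Lemma square_integrable_comb (I : finType) (e : I -> R[i] * R[i] -> R[i])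
    (c : I -> R[i]) : (forall i, square_integrable (e i)) ->
  square_integrable (fun z => \sum_i c i * e i z).
Proof.
by move=> se; apply: square_integrable_sum => i; exact: square_integrableZ.
Qed.

Lemma parseval (I : finType) (e : I -> R[i] * R[i] -> R[i])
    (c : I -> R[i]) : orthonormal_family e ->
  (\int[T]_t abs2 (\sum_i c i * e i (torus_point t)))%R = \sum_i abs2 (c i).
Proof.
move=> oe; have [se _] := oe; have sp := square_integrable_comb c se.
apply: (@complexI R); rewrite -(inner_self (fun z => \sum_i c i * e i z)).
rewrite inner_suml// rmorph_sum /=; apply: eq_bigr => i _.
by rewrite innerC// inner_orthonormal// mulcJ_abs2.
Qed.

(** The projection [p] of [f] leaves a remainder [r = f - p] orthogonal to
    every [e i], hence to [p], so [|r|^2 = <r, f> = |f|^2 - sum |c i|^2]. *)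
Lemma bessel (I : finType) (e : I -> R[i] * R[i] -> R[i]) f :
  orthonormal_family e -> square_integrable f ->
  \sum_i abs2 (inner f (e i)) <= (\int[T]_t abs2 (f (torus_point t)))%R.
Proof.
move=> oe sf; have [se _] := oe.
pose c i := inner f (e i); pose p := fun z => \sum_i c i * e i z.
have sp : square_integrable p by exact: square_integrable_comb.
pose r := fun z => f z - p z.
have sr : square_integrable r.
  have := square_integrableD sf (square_integrableZ (-1) sp).
  by congr square_integrable; apply/funext => z; rewrite mulN1r.
have re0 i : inner r (e i) = 0.
  by rewrite innerBl// inner_orthonormal// subrr.
have pr0 : inner p r = 0.
  by rewrite inner_suml// big1// => i _; rewrite innerC// re0 conjc0 mulr0.
have rf : inner r f = ((\int[T]_t abs2 (f (torus_point t)))%R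
    - \sum_i abs2 (c i))%:C.
  rewrite innerBl// inner_self inner_suml// rmorphB rmorph_sum /=.
  congr (_ - _); apply: eq_bigr => i _.
  by rewrite (innerC sf (se i)) mulcJ_abs2.
have : 0 <= inner r r.
  by rewrite inner_self ler0c Rintegral_ge0// => t _; exact: abs2_ge0.
by rewrite innerBl// pr0 subr0 (innerC sr sf) rf conjc_real ler0c subr_ge0.
Qed.

Definition monomial (m n : nat) (z : R[i] * R[i]) : R[i] := z.1 ^+ m * z.2 ^+ n.

Lemma expr_cos_sin (s : R) (m : nat) :
  (cos s +i* sin s) ^+ m = cos (m%:R * s) +i* sin (m%:R * s).
Proof.
elim: m => [|m ih]; first by rewrite expr0 mul0r cos0 sin0.
rewrite exprS ih; apply/eqP; rewrite eq_complex /= -natr1 mulrDl mul1r.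
by rewrite cosD sinD; apply/andP; split; apply/eqP; ring.
Qed.

(** The quarter period phase writes the sine as a cosine, so that one family of
    integrals serves both components. *)
Lemma monomial_waveE (m n p q : nat) (t : R * R) :
  monomial m n (torus_point t) * (monomial p q (torus_point t))^* =
  cos ((m%:R - p%:R) * t.1 + (n%:R - q%:R) * t.2 + 0) +i*
  cos ((m%:R - p%:R) * t.1 + (n%:R - q%:R) * t.2 + - (pi / 2)).
Proof.
rewrite cosBpihalf addr0 /monomial /torus_point /= !expr_cos_sin /=.
have -> : (m%:R - p%:R) * t.1 + (n%:R - q%:R) * t.2 =
  (m%:R * t.1 + n%:R * t.2) - (p%:R * t.1 + q%:R * t.2) by ring.
rewrite cosB sinB !cosD !sinD.
by apply/eqP; rewrite eq_complex /=; apply/andP; split; apply/eqP; ring.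
Qed.

Lemma monomial_torusE (m n : nat) (t : R * R) :
  monomial m n (torus_point t) =
  cos ((m%:R - 0%:R) * t.1 + (n%:R - 0%:R) * t.2 + 0) +i*
  cos ((m%:R - 0%:R) * t.1 + (n%:R - 0%:R) * t.2 + - (pi / 2)).
Proof.
rewrite -monomial_waveE (_ : monomial 0 0 _ = 1); last exact: mulr1.
by rewrite rmorph1 mulr1.
Qed.

Lemma square_integrable_monomial m n : square_integrable (monomial m n).
Proof.
apply: (@square_integrable_le _ (fun=> 1)).
- split.
  + have := measurable_torus_wave (m%:R - 0%:R) (n%:R - 0%:R) 0.
    by congr measurable_fun; apply/funext => t; rewrite monomial_torusE.
  + have := measurable_torus_wave (m%:R - 0%:R) (n%:R - 0%:R) (- (pi / 2)).
    by congr measurable_fun; apply/funext => t; rewrite monomial_torusE.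
- by apply: (@bounded_torus_integrable _ 1) => // t; rewrite normr1.
- move=> t; rewrite monomial_torusE /abs2 /= cosBpihalf addr0.
  by rewrite cos2Dsin2.
Qed.

Lemma inner_monomial m n p q :
  inner (monomial m n) (monomial p q) = ((m == p) && (n == q))%:R.
Proof.
rewrite /inner /torus_integral; case: (boolP (_ && _)) => [/andP[/eqP -> /eqP ->]|mn].
  transitivity (Complex (\int[T]_t (1 : R))%R (\int[T]_t (0 : R))%R); last first.
    by rewrite !Rintegral_torus_cst.
  congr Complex; congr Rintegral; apply/funext => t; rewrite monomial_waveE /=.
    by rewrite !subrr !mul0r !addr0 cos0.
  by rewrite !subrr !mul0r !add0r cosN cos_pihalf.
transitivity (Complex (0 : R) (0 : R)); last by [].
congr Complex.
- rewrite -[RHS](Rintegral_torus_wave 0 mn); congr Rintegral.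
  by apply/funext => t; rewrite monomial_waveE.
- rewrite -[RHS](Rintegral_torus_wave (- (pi / 2)) mn); congr Rintegral.
  by apply/funext => t; rewrite monomial_waveE.
Qed.

End TorusIntegral.

(** * Square partial sums of double power series *)

Section DoubleSeries.
Variable R : realType.

Lemma geometric_half_le2 (N : nat) : \sum_(m < N) (2^-1 : R) ^+ m <= 2.
Proof.
have -> : \sum_(m < N) (2^-1 : R) ^+ m = 2 - 2 * 2^-1 ^+ N.
  elim: N => [|N ih]; first by rewrite big_ord0 expr0 mulr1 subrr.
  by rewrite big_ord_recr /= ih exprS; field.
by rewrite gerBl mulr_ge0// exprn_ge0// invr_ge0.
Qed.

Definition square_sum (V : zmodType) (a : nat -> nat -> V) (N : nat) : V :=
  \sum_(m < N) \sum_(n < N) a m n.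

Lemma square_sum_trunc (V : zmodType) (a : nat -> nat -> V) (K N : nat) :
  (K <= N)%N -> (forall m n, (K <= m)%N || (K <= n)%N -> a m n = 0) ->
  square_sum a N = square_sum a K.
Proof.
move=> KN a0; rewrite /square_sum [RHS](big_ord_widen N (fun m => \sum_(n < K) a m n))//.
rewrite [RHS]big_mkcond /=; apply: eq_bigr => m _; case: ltnP => mK; last first.
  by rewrite big1// => n _; rewrite a0// mK.
rewrite [RHS](big_ord_widen N (a m))// [RHS]big_mkcond /=; apply: eq_bigr => n _.
by case: ltnP => // nK; rewrite a0// nK orbT.
Qed.

Lemma square_sumD (V : zmodType) (a b : nat -> nat -> V) N :
  square_sum (fun m n => a m n + b m n) N = square_sum a N + square_sum b N.
Proof.
by rewrite /square_sum -big_split /=; apply: eq_bigr => m _; rewrite big_split.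
Qed.

Lemma square_sum_norm_le (a : nat -> nat -> R) (B : R) N :
  (forall m n, `|a m n| <= B * (2^-1 ^+ m * 2^-1 ^+ n)) ->
  `|square_sum a N| <= 4 * B.
Proof.
move=> aB; have B0 : 0 <= B.
  by have := le_trans (normr_ge0 _) (aB 0%N 0%N); rewrite !expr0 !mulr1.
apply: (@le_trans _ _ (\sum_(m < N) \sum_(n < N) B * (2^-1 ^+ m * 2^-1 ^+ n))).
  apply: le_trans (ler_norm_sum _ _ _) _; apply: ler_sum => m _.
  by apply: le_trans (ler_norm_sum _ _ _) _; apply: ler_sum => n _.
have -> : \sum_(m < N) \sum_(n < N) B * (2^-1 ^+ m * 2^-1 ^+ n) =
    B * ((\sum_(m < N) 2^-1 ^+ m) * (\sum_(n < N) 2^-1 ^+ n)).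
  rewrite mulr_suml mulr_sumr; apply: eq_bigr => m _.
  by rewrite mulr_sumr mulr_sumr.
rewrite mulrC ler_wpM2r// (_ : 4 = 2 * 2); last by ring.
have g0 : 0 <= \sum_(m < N) (2^-1 : R) ^+ m.
  by apply: sumr_ge0 => m _; rewrite exprn_ge0// invr_ge0.
by apply: ler_pM => //; exact: geometric_half_le2.
Qed.

Lemma square_sum_cvg_ge0 (a : nat -> nat -> R) (B : R) :
  (forall m n, 0 <= a m n) ->
  (forall m n, a m n <= B * (2^-1 ^+ m * 2^-1 ^+ n)) ->
  cvgn (square_sum a).
Proof.
move=> a0 aB; apply: nondecreasing_is_cvgn.
  apply/nondecreasing_seqP => N; rewrite /square_sum big_ord_recr /= -[leLHS]addr0.
  apply: lerD; last by apply: sumr_ge0.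
  apply: ler_sum => m _; rewrite big_ord_recr /= lerDl; exact: a0.
exists (4 * B) => _ [N _ <-]; apply: le_trans (ler_norm _) _.
by apply: square_sum_norm_le => m n; rewrite ger0_norm.
Qed.

(** Adding the dominating geometric array makes the terms nonnegative; the sums
    are then a difference of two bounded monotone sequences. *)
Lemma square_sum_cvg (a : nat -> nat -> R) (B : R) :
  (forall m n, `|a m n| <= B * (2^-1 ^+ m * 2^-1 ^+ n)) ->
  cvgn (square_sum a).
Proof.
move=> aB; pose b m n : R := B * (2^-1 ^+ m * 2^-1 ^+ n).
have b0 m n : 0 <= b m n by exact: le_trans (aB m n).
have -> : square_sum a = square_sum (fun m n => a m n + b m n) \- square_sum b.
  by apply/funext => N /=; rewrite square_sumD addrK.
apply: is_cvgB.
- apply: (@square_sum_cvg_ge0 _ (2 * B)) => m n.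
    by have := aB m n; rewrite ler_norml => /andP[+ _]; rewrite -/(b m n); lra.
  have := aB m n; rewrite ler_norml => /andP[_ +].
  by rewrite -mulrA -/(b m n); lra.
- by apply: (@square_sum_cvg_ge0 _ B).
Qed.

(** The terms of total degree at most two. *)
Definition low_part (V : zmodType) (a : nat -> nat -> V) : V :=
  a 0%N 0%N + (a 1%N 0%N + a 0%N 1%N) +
  (a 2%N 0%N + a 1%N 1%N + a 0%N 2%N).

(** A term of degree [k >= 3] is at most [B t^3 2^-(k-3) = 8 B t^3 2^-k], and the
    double geometric series with ratio one half sums to at most [4]. *)
Lemma square_sum_low (a : nat -> nat -> R) (B t : R) :
  0 <= t <= 2^-1 -> (forall m n, `|a m n| <= B * t ^+ (m + n)) ->
  forall N, (3 <= N)%N -> `|square_sum a N - low_part a| <= 32 * B * t ^+ 3.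
Proof.
move=> /andP[t0 t12] aB N N3.
have B0 : 0 <= B.
  by have := le_trans (normr_ge0 _) (aB 0%N 0%N); rewrite expr0 mulr1.
pose lo m n := if (m + n < 3)%N then a m n else 0.
pose hi m n := if (m + n < 3)%N then 0 else a m n.
have -> : square_sum a N = square_sum hi N + square_sum lo N.
  rewrite -square_sumD; apply: eq_bigr => m _; apply: eq_bigr => n _.
  by rewrite /hi /lo; case: ifP; rewrite ?addr0 ?add0r.
have -> : square_sum lo N = low_part a.
  rewrite (@square_sum_trunc _ _ 3)//; last first.
    by move=> m n /orP[] h; rewrite /lo ltnNge (leq_trans h) ?leq_addr ?leq_addl.
  rewrite /square_sum !big_ord_recl !big_ord0 /low_part /lo /=.
  by rewrite /bump /= !addr0; ring.
rewrite addrK (_ : 32 * B * t ^+ 3 = 4 * (8 * B * t ^+ 3)); last by ring.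
apply: square_sum_norm_le => m n; rewrite /hi; case: ltnP => mn.
  by rewrite normr0 !mulr_ge0// ?exprn_ge0// invr_ge0.
apply: le_trans (aB m n) _; rewrite -exprD -(subnK mn) exprD.
rewrite [X in _ <= X](_ : _ = B * (2^-1 ^+ (m + n - 3) * t ^+ 3)).
  by rewrite ler_wpM2l// ler_wpM2r ?exprn_ge0// lerXn2r// nnegrE invr_ge0.
by rewrite exprD; field.
Qed.

End DoubleSeries.

(** * Holomorphic extensions and their Taylor expansion at the origin *)

Section HolomorphicExtension.
Variable R : realType.
Implicit Types (f g : R[i] * R[i] -> R[i]) (z w : R[i]).
Local Notation T := (@torus_measure R).
Local Notation normc := Normc.normc.

Lemma normc_sqr z : normc z ^+ 2 = abs2 z.
Proof. by case: z => a b; rewrite /= sqr_sqrtr// addr_ge0// sqr_ge0. Qed.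

Lemma normc_ge0 z : 0 <= normc z.
Proof. by case: z => a b; exact: sqrtr_ge0. Qed.

Lemma normcX z n : normc (z ^+ n) = normc z ^+ n.
Proof.
elim: n => [|n ih]; first by rewrite !expr0 /= expr1n expr0n addr0 sqrtr1.
by rewrite !exprS Normc.normcM ih.
Qed.

Lemma normc_triangle z w : normc (z + w) <= normc z + normc w.
Proof. exact: le_normcD. Qed.

Lemma normc_opp z : normc (- z) = normc z.
Proof. exact: normcN. Qed.

Lemma Re_le_normc z : `|complex.Re z| <= normc z.
Proof.
case: z => a b /=; rewrite -sqrtr_sqr ler_sqrt ?addr_ge0 ?sqr_ge0//.
by rewrite lerDl sqr_ge0.
Qed.

Lemma Im_le_normc z : `|complex.Im z| <= normc z.
Proof.
case: z => a b /=; rewrite -sqrtr_sqr ler_sqrt ?addr_ge0 ?sqr_ge0//.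
by rewrite lerDr sqr_ge0.
Qed.

Lemma normc_le_ReIm z : normc z <= `|complex.Re z| + `|complex.Im z|.
Proof.
rewrite -(@ler_pXn2r _ 2) ?nnegrE ?addr_ge0 ?normc_ge0//.
rewrite normc_sqr /abs2 -(real_normK (num_real (complex.Re z))).
rewrite -(real_normK (num_real (complex.Im z))) sqrrD.
by rewrite [leRHS]addrAC lerDl mulrn_wge0// mulr_ge0.
Qed.

Lemma Re_cvg (u : nat -> R[i]) (l : R[i]) :
  ((u : nat -> R[i]^o) @ \oo --> (l : R[i]^o)) ->
  (fun n => complex.Re (u n)) @ \oo --> complex.Re l.
Proof.
move=> /cvgrPdist_lt ul; apply/cvgrPdist_lt => e e0.
have e0' : 0 < e%:C :> R[i] by rewrite ltcR.
have := ul _ e0'; apply: filterS => n.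
change ((normc (l - u n))%:C < e%:C -> `|complex.Re l - complex.Re (u n)| < e).
rewrite ltcR; apply: le_lt_trans; apply: le_trans (Re_le_normc _).
by case: (l) => a b; case: (u n).
Qed.

Lemma complex_cvg (u : nat -> R[i]) (a b : R) :
  (fun n => complex.Re (u n)) @ \oo --> a ->
  (fun n => complex.Im (u n)) @ \oo --> b ->
  ((u : nat -> R[i]^o) @ \oo --> ((a +i* b) : R[i]^o)).
Proof.
move=> /cvgrPdist_lt ua /cvgrPdist_lt ub; apply/cvgrPdist_lt => e.
case: e => e i; rewrite ltcE /= => /andP[/eqP -> e0].
have e20 : 0 < e / 2 by rewrite divr_gt0.
apply: filterS2 (ua _ e20) (ub _ e20) => n ha hb.
change ((normc ((a +i* b) - u n))%:C < e%:C); rewrite ltcR.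
apply: le_lt_trans (normc_le_ReIm _) _; case: (u n) ha hb => x y /=; lra.
Qed.

Definition norm2 f : R := Num.sqrt (\int[T]_t abs2 (f (torus_point t)))%R.

Lemma norm2_ge0 f : 0 <= norm2 f. Proof. exact: sqrtr_ge0. Qed.

Lemma norm2_sqr f : norm2 f ^+ 2 = (\int[T]_t abs2 (f (torus_point t)))%R.
Proof. by rewrite sqr_sqrtr// Rintegral_ge0// => t _; exact: abs2_ge0. Qed.

Lemma L2norm_norm2 f : L2 f -> L2norm f = (norm2 f)%:E.
Proof. by move=> /L2_square_integrable; exact: L2normE. Qed.

Definition monomials N (i : 'I_N * 'I_N) : R[i] * R[i] -> R[i] :=
  monomial i.1 i.2.

Lemma orthonormal_monomials N : orthonormal_family (@monomials N).
Proof.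
split=> [i|i j]; first exact: square_integrable_monomial.
by rewrite inner_monomial; case: i j => i1 i2 [j1 j2].
Qed.

Lemma fourier_coef_inner f m n : fourier_coef f m n = inner f (monomial m n).
Proof. by []. Qed.

Lemma bessel_fourier f N : L2 f ->
  square_sum (fun m n => abs2 (fourier_coef f m n)) N <= norm2 f ^+ 2.
Proof.
move=> /L2_square_integrable sf; rewrite norm2_sqr.
have := bessel (orthonormal_monomials N) sf.
by rewrite /square_sum pair_big.
Qed.

Lemma fourier_coef_le f m n : L2 f -> normc (fourier_coef f m n) <= norm2 f.
Proof.
move=> sf; rewrite -(@ler_pXn2r _ 2) ?nnegrE ?normc_ge0 ?norm2_ge0// normc_sqr.
pose N := (maxn m n).+1; apply: le_trans (bessel_fourier N sf).
have mN : (m < N)%N by rewrite ltnS leq_maxl.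
have nN : (n < N)%N by rewrite ltnS leq_maxr.
rewrite /square_sum (bigD1 (Ordinal mN))//= (bigD1 (Ordinal nN))//= -addrA lerDl.
rewrite addr_ge0// sumr_ge0// => i _; first exact: abs2_ge0.
by rewrite sumr_ge0// => j _; exact: abs2_ge0.
Qed.

Definition power_term (c : nat -> nat -> R[i]) (z : R[i] * R[i]) (m n : nat)
    : R[i] :=
  c m n * z.1 ^+ m * z.2 ^+ n.

Lemma power_term_le f (z : R[i] * R[i]) (t : R) : L2 f ->
  normc z.1 <= t -> normc z.2 <= t ->
  forall m n, normc (power_term (fourier_coef f) z m n) <= norm2 f * t ^+ (m + n).
Proof.
move=> Lf z1 z2 m n; rewrite /power_term !Normc.normcM !normcX exprD mulrA.
have t0 : 0 <= t by exact: le_trans (normc_ge0 _) z1.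
apply: ler_pM; rewrite ?mulr_ge0 ?exprn_ge0 ?normc_ge0//; last first.
  by rewrite lerXn2r// ?nnegrE ?normc_ge0.
apply: ler_pM; rewrite ?exprn_ge0 ?normc_ge0//; first exact: fourier_coef_le.
by rewrite lerXn2r// ?nnegrE ?normc_ge0.
Qed.

Lemma Re_square_sum (a : nat -> nat -> R[i]) N :
  complex.Re (square_sum a N) = square_sum (fun m n => complex.Re (a m n)) N.
Proof.
rewrite /square_sum.
have ReD (x y : R[i]) : complex.Re (x + y) = complex.Re x + complex.Re y.
  by case: x y => ? ? [].
rewrite (big_morph _ ReD (id1 := 0))//; apply: eq_bigr => m _.
by rewrite (big_morph _ ReD (id1 := 0)).
Qed.

Lemma Im_square_sum (a : nat -> nat -> R[i]) N :
  complex.Im (square_sum a N) = square_sum (fun m n => complex.Im (a m n)) N.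
Proof.
rewrite /square_sum.
have ImD (x y : R[i]) : complex.Im (x + y) = complex.Im x + complex.Im y.
  by case: x y => ? ? [].
rewrite (big_morph _ ImD (id1 := 0))//; apply: eq_bigr => m _.
by rewrite (big_morph _ ImD (id1 := 0)).
Qed.

(** Bessel's inequality bounds every coefficient by the norm, which makes the
    remainder proportional to the norm. The constant is [2 * 32]: the estimate
    [square_sum_low] for the real and for the imaginary part. *)
Lemma hol_ext_low f (z : R[i] * R[i]) (t : R) : L2 f -> 0 <= t <= 2^-1 ->
  normc z.1 <= t -> normc z.2 <= t ->
  normc (hol_ext f z - low_part (power_term (fourier_coef f) z)) <= 64 * norm2 f * t ^+ 3.
Proof.
move=> Lf t012 z1 z2; have /andP[t0 t12] := t012.
have le_t := power_term_le Lf z1 z2.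
pose ar m n := complex.Re (power_term (fourier_coef f) z m n).
pose ai m n := complex.Im (power_term (fourier_coef f) z m n).
have ler_t m n : `|ar m n| <= norm2 f * t ^+ (m + n).
  exact: le_trans (Re_le_normc _) (le_t m n).
have lei_t m n : `|ai m n| <= norm2 f * t ^+ (m + n).
  exact: le_trans (Im_le_normc _) (le_t m n).
have le_half m n : norm2 f * t ^+ (m + n) <= norm2 f * (2^-1 ^+ m * 2^-1 ^+ n).
  by rewrite -exprD ler_wpM2l ?norm2_ge0// lerXn2r// ?nnegrE invr_ge0.
have cr : cvgn (square_sum ar).
  by apply: (@square_sum_cvg _ _ (norm2 f)) => m n; exact: le_trans (le_half m n).
have ci : cvgn (square_sum ai).
  by apply: (@square_sum_cvg _ _ (norm2 f)) => m n; exact: le_trans (le_half m n).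
have -> : hol_ext f z = limn (square_sum ar) +i* limn (square_sum ai).
  apply: (@cvg_lim R[i]^o); first exact: norm_hausdorff.
  apply: complex_cvg.
  - rewrite (_ : (fun _ => _) = square_sum ar)//; apply/funext => N.
    exact: (Re_square_sum (power_term (fourier_coef f) z)).
  - rewrite (_ : (fun _ => _) = square_sum ai)//; apply/funext => N.
    exact: (Im_square_sum (power_term (fourier_coef f) z)).
have lim_low (a : nat -> nat -> R) : cvgn (square_sum a) ->
    (forall m n, `|a m n| <= norm2 f * t ^+ (m + n)) ->
    `|limn (square_sum a) - low_part a| <= 32 * norm2 f * t ^+ 3.
  move=> ca la.
  have := square_sum_low t012 la => h.
  have cal : (fun N => `|square_sum a N - low_part a|) @ \oo -->
      `|limn (square_sum a) - low_part a|.
    by apply: cvg_norm; apply: cvgB => //; exact: cvg_cst.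
  by apply: (cvgr_to_le cal); exists 3%N.
apply: le_trans (normc_le_ReIm _) _.
rewrite (_ : 64 * norm2 f * t ^+ 3 =
  32 * norm2 f * t ^+ 3 + 32 * norm2 f * t ^+ 3); last by ring.
apply: lerD.
- rewrite (_ : complex.Re _ = limn (square_sum ar) - low_part ar); first exact: lim_low.
  rewrite /low_part /ar; do 6! case: (power_term _ _ _ _) => ? ?; by [].
- rewrite (_ : complex.Im _ = limn (square_sum ai) - low_part ai); first exact: lim_low.
  rewrite /low_part /ai; do 6! case: (power_term _ _ _ _) => ? ?; by [].
Qed.

End HolomorphicExtension.

(** * The dual functional on products *)

Section LowerBound.
Variable R : realType.
Implicit Types (z w : R[i]) (f g h F : R[i] * R[i] -> R[i]).
Local Notation normc := Normc.normc.

(** The value on a product [g h] of the functional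
    [f |-> a (f_20 + f_02) + b f_11], in terms of the coefficients [c] of [g]
    and [d] of [h]. *)
Definition degree2_form (a b : R) (c d : nat -> nat -> R[i]) : R[i] :=
  c 0%N 0%N * (a%:C * (d 2%N 0%N + d 0%N 2%N) + b%:C * d 1%N 1%N) +
  (a%:C * (c 2%N 0%N + c 0%N 2%N) + b%:C * c 1%N 1%N) * d 0%N 0%N +
  (a%:C * (c 1%N 0%N * d 1%N 0%N + c 0%N 1%N * d 0%N 1%N) +
   b%:C * (c 1%N 0%N * d 0%N 1%N + c 0%N 1%N * d 1%N 0%N)).

Lemma Re_mul_le z w : 2 * complex.Re (z * w) <= abs2 z + abs2 w.
Proof.
case: z w => a b [c d]; rewrite /abs2 /= -subr_ge0.
rewrite (_ : _ - _ = (a - c) ^+ 2 + (b + d) ^+ 2); last by ring.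
by rewrite addr_ge0// sqr_ge0.
Qed.

(** Cauchy-Schwarz for the row [(a, b, a)], by Lagrange's identity. *)
Lemma abs2_row_le (a b : R) (x y z : R[i]) : 2 * a ^+ 2 + b ^+ 2 <= 1 ->
  abs2 (a%:C * (x + z) + b%:C * y) <= abs2 x + abs2 y + abs2 z.
Proof.
move=> ab; apply: (@le_trans _ _ ((2 * a ^+ 2 + b ^+ 2) * (abs2 x + abs2 y + abs2 z))).
  case: x y z => x x' [y y'] [z z']; rewrite /abs2 /= -subr_ge0.
  rewrite (_ : _ - _ = (a * y - b * x) ^+ 2 + (a * z - a * x) ^+ 2 +
    (b * z - a * y) ^+ 2 + ((a * y' - b * x') ^+ 2 + (a * z' - a * x') ^+ 2 +
    (b * z' - a * y') ^+ 2)); last by ring.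
  by rewrite !addr_ge0 ?sqr_ge0.
by apply: ler_piMl => //; rewrite !addr_ge0 ?sqr_ge0.
Qed.

Lemma ReD z w : complex.Re (z + w) = complex.Re z + complex.Re w.
Proof. by case: z w => ? ? []. Qed.

Lemma ReZ (a : R) w : complex.Re (a%:C * w) = a * complex.Re w.
Proof. by case: w => u v /=; rewrite mul0r subr0. Qed.

(** The hypothesis [2 a^2 + b^2 <= 1] controls the two blocks that pair degree
    zero with degree two, and [a + b <= 1] the block that pairs degree one with
    itself. *)
Lemma degree2_form_le_add (a b : R) c d : 0 <= a -> 0 <= b -> a + b <= 1 ->
  2 * a ^+ 2 + b ^+ 2 <= 1 ->
  2 * complex.Re (degree2_form a b c d) <=
  low_part (fun m n => abs2 (c m n)) + low_part (fun m n => abs2 (d m n)).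
Proof.
move=> a0 b0 ab1 ab2; rewrite /degree2_form /low_part /= !ReD !ReZ !ReD.
have h1 := Re_mul_le (c 0%N 0%N) (a%:C * (d 2%N 0%N + d 0%N 2%N) + b%:C * d 1%N 1%N).
have h2 := Re_mul_le (a%:C * (c 2%N 0%N + c 0%N 2%N) + b%:C * c 1%N 1%N) (d 0%N 0%N).
have h3 := abs2_row_le (d 2%N 0%N) (d 1%N 1%N) (d 0%N 2%N) ab2.
have h4 := abs2_row_le (c 2%N 0%N) (c 1%N 1%N) (c 0%N 2%N) ab2.
have h5 := ler_wpM2l a0 (lerD (Re_mul_le (c 1%N 0%N) (d 1%N 0%N))
  (Re_mul_le (c 0%N 1%N) (d 0%N 1%N))).
have h6 := ler_wpM2l b0 (lerD (Re_mul_le (c 1%N 0%N) (d 0%N 1%N))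
  (Re_mul_le (c 0%N 1%N) (d 1%N 0%N))).
have h7 : (a + b) * (abs2 (c 1%N 0%N) + abs2 (c 0%N 1%N) + abs2 (d 1%N 0%N) +
    abs2 (d 0%N 1%N)) <= abs2 (c 1%N 0%N) + abs2 (c 0%N 1%N) +
    abs2 (d 1%N 0%N) + abs2 (d 0%N 1%N).
  by apply: ler_piMl => //; rewrite !addr_ge0 ?sqr_ge0.
by move: h1 h2 h3 h4 h5 h6 h7; lra.
Qed.

Lemma le_mul_of_forall_scaled (x A B : R) : 0 <= A -> 0 <= B ->
  (forall l : R, 2 * (l * x) <= l ^+ 2 * A ^+ 2 + B ^+ 2) -> x <= A * B.
Proof.
move=> A0 B0 H; have [x0|x0] := leP x 0; first exact: le_trans (mulr_ge0 A0 B0).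
move: A0; rewrite le_eqVlt => /predU1P[A0|A0].
  have := H ((B ^+ 2 + 1) / (2 * x)); rewrite -A0 expr0n mulr0 add0r.
  rewrite (_ : 2 * (_ * x) = B ^+ 2 + 1); first by lra.
  by field; rewrite gt_eqF.
have := H (x / A ^+ 2); rewrite (_ : 2 * _ = 2 * (x ^+ 2 / A ^+ 2)); last by ring.
rewrite (_ : _ * A ^+ 2 = x ^+ 2 / A ^+ 2); last by field; rewrite gt_eqF.
move=> h; have : x ^+ 2 / A ^+ 2 <= B ^+ 2 by lra.
rewrite ler_pdivrMr ?exprn_gt0// -exprMn [A * B]mulrC.
by rewrite ler_pXn2r// nnegrE; [exact: ltW|rewrite mulr_ge0// ltW].
Qed.

Lemma low_part_le_square_sum (u : nat -> nat -> R) :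
  (forall m n, 0 <= u m n) -> low_part u <= square_sum u 3.
Proof.
move=> u0; rewrite /square_sum !big_ord_recl !big_ord0 /low_part /bump /= !addr0.
by move: (u0 1%N 2%N) (u0 2%N 1%N) (u0 2%N 2%N); rewrite /addn /=; lra.
Qed.

Lemma low_part_abs2_le f : L2 f ->
  low_part (fun m n => abs2 (fourier_coef f m n)) <= norm2 f ^+ 2.
Proof.
move=> Lf; apply: le_trans (bessel_fourier 3 Lf).
by apply: low_part_le_square_sum => m n; exact: abs2_ge0.
Qed.

Lemma low_partZ (l : R) (u : nat -> nat -> R) :
  low_part (fun m n => l * u m n) = l * low_part u.
Proof. by rewrite /low_part -!mulrDr. Qed.

Lemma degree2_formZ (a b l : R) c d :
  degree2_form a b (fun m n => l%:C * c m n) d = l%:C * degree2_form a b c d.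
Proof. by rewrite /degree2_form; ring. Qed.

(** Bilinearity improves the bound by half the sum of squares to the product:
    apply it to [l g] and [h] for all real [l]. *)
Lemma degree2_form_le (a b : R) g h : 0 <= a -> 0 <= b -> a + b <= 1 ->
  2 * a ^+ 2 + b ^+ 2 <= 1 -> L2 g -> L2 h ->
  complex.Re (degree2_form a b (fourier_coef g) (fourier_coef h)) <=
  norm2 g * norm2 h.
Proof.
move=> a0 b0 ab1 ab2 Lg Lh; apply: le_mul_of_forall_scaled.
- exact: norm2_ge0.
- exact: norm2_ge0.
move=> l; have := degree2_form_le_add
  (fun m n => l%:C * fourier_coef g m n) (fourier_coef h) a0 b0 ab1 ab2.
rewrite degree2_formZ ReZ => /le_trans; apply.
apply: lerD; last exact: low_part_abs2_le.
under [X in low_part X]eq_fun2 do rewrite abs2M.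
rewrite low_partZ (_ : abs2 l%:C = l ^+ 2).
  by rewrite ler_wpM2l ?sqr_ge0// low_part_abs2_le.
by rewrite /abs2 /= expr0n addr0.
Qed.

Definition second_difference F (x y : R) : R[i] :=
  F (x%:C, y%:C) + F ((- x)%:C, (- y)%:C) - 2 * F (0, 0).

(** Second differences along the two diagonals kill degrees zero, one and three;
    on the diagonals [z1 z2] is plus or minus [z1^2], so the weights [a + b] and
    [a - b] recover [a (f_20 + f_02) + b f_11], with a factor [4 t^2]. *)
Definition degree2_test (a b t : R) F : R[i] :=
  (a + b)%:C * second_difference F t t +
  (a - b)%:C * second_difference F t (- t).

(** The products of degree three cancel in the second differences; the remaining
    error is the product of the two degree two parts. *)
Lemma degree2_test_low (a b t : R) (c d : nat -> nat -> R[i]) :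
  degree2_test a b t
    (fun z : R[i] * R[i] => low_part (power_term c z) * low_part (power_term d z)) =
  (4 * t ^+ 2)%:C * degree2_form a b c d +
  (2 * t ^+ 4)%:C * (
    (a + b)%:C * ((c 2%N 0%N + c 1%N 1%N + c 0%N 2%N) *
                  (d 2%N 0%N + d 1%N 1%N + d 0%N 2%N)) +
    (a - b)%:C * ((c 2%N 0%N - c 1%N 1%N + c 0%N 2%N) *
                  (d 2%N 0%N - d 1%N 1%N + d 0%N 2%N))).
Proof.
rewrite /degree2_test /second_difference /low_part /power_term /degree2_form /=.
rewrite (_ : (4 * t ^+ 2)%:C = 4 * t%:C ^+ 2); last first.
  by rewrite rmorphM rmorphXn rmorph_nat.
rewrite (_ : (2 * t ^+ 4)%:C = 2 * t%:C ^+ 4); last first.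
  by rewrite rmorphM rmorphXn rmorph_nat.
rewrite opprK !rmorphD !rmorphN /= !expr0 !expr1 !expr0n /=.
ring.
Qed.

Lemma degree2_test_phi (a b t alpha : R) :
  complex.Re (degree2_test a b t (phi alpha)) = 4 * t ^+ 2 * (2 * a + b * alpha).
Proof.
have -> : degree2_test a b t (phi alpha) = (4 * t ^+ 2 * (2 * a + b * alpha))%:C.
  rewrite /degree2_test /second_difference /phi /=.
  rewrite (_ : (4 * t ^+ 2 * (2 * a + b * alpha))%:C =
    4 * t%:C ^+ 2 * (2 * a%:C + b%:C * alpha%:C)); last first.
    rewrite rmorphM (rmorphM _ 4) rmorphXn (rmorphD _ (2 * a)).
    by rewrite (rmorphM _ 2) (rmorphM _ b) !rmorph_nat.
  rewrite opprK !rmorphD !rmorphN /= !expr0n /=.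
  ring.
by [].
Qed.

Lemma Re_degree2_test (a b t : R) F :
  complex.Re (degree2_test a b t F) =
  (a + b) * (complex.Re (F (t%:C, t%:C)) + complex.Re (F ((- t)%:C, (- t)%:C))
    - 2 * complex.Re (F (0, 0))) +
  (a - b) * (complex.Re (F (t%:C, (- t)%:C)) + complex.Re (F ((- t)%:C, t%:C))
    - 2 * complex.Re (F (0, 0))).
Proof.
rewrite /degree2_test /second_difference ReD !ReZ opprK.
have ReB (z w w' : R[i]) : complex.Re (z + w - 2 * w') =
    complex.Re z + complex.Re w - 2 * complex.Re w'.
  by case: z w w' => ? ? [? ?] [? ?] /=; ring.
by rewrite !ReB.
Qed.

Lemma normc_real (t : R) : normc t%:C = `|t|.
Proof. by rewrite /= expr0n addr0 sqrtr_sqr. Qed.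

(** The values enter with weights at most [1, 1, 2] on each diagonal: [8] in
    total. *)
Lemma degree2_test_close (a b t e : R) F F' :
  0 <= t -> `|a + b| <= 1 -> `|a - b| <= 1 ->
  (forall z : R[i] * R[i], normc z.1 <= t -> normc z.2 <= t ->
    normc (F z - F' z) <= e) ->
  complex.Re (degree2_test a b t F) <= complex.Re (degree2_test a b t F') + 8 * e.
Proof.
move=> t0 ab ab' FF'.
have close (z : R[i] * R[i]) : normc z.1 <= t -> normc z.2 <= t ->
    `|complex.Re (F z) - complex.Re (F' z)| <= e.
  move=> z1 z2; apply: le_trans (FF' z z1 z2); apply: le_trans (Re_le_normc _).
  by case: (F z) => ? ?; case: (F' z).
have tt : normc t%:C <= t by rewrite normc_real ger0_norm.
have tN : normc (- t)%:C <= t by rewrite normc_real normrN ger0_norm.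
have t00 : normc (0 : R[i]) <= t by rewrite Normc.normc0.
rewrite !Re_degree2_test.
have := close (t%:C, t%:C) tt tt; have := close ((- t)%:C, (- t)%:C) tN tN.
have := close (t%:C, (- t)%:C) tt tN; have := close ((- t)%:C, t%:C) tN tt.
have := close (0, 0) t00 t00.
rewrite !ler_norml => /andP[h1 h2] /andP[h3 h4] /andP[h5 h6] /andP[h7 h8] /andP[h9 h10].
have mul_le (u x y : R) : `|u| <= 1 -> x - y <= 4 * e -> y - x <= 4 * e ->
    u * x <= u * y + 4 * e.
  move=> u1 xy yx; rewrite -lerBlDl -mulrBr; apply: le_trans (ler_norm _) _.
  rewrite normrM; apply: (@le_trans _ _ (1 * `|x - y|)); first by rewrite ler_wpM2r.
  by rewrite mul1r ler_norml; apply/andP; split; lra.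
rewrite (_ : 8 * e = 4 * e + 4 * e); last by ring.
rewrite addrACA; apply: lerD; apply: mul_le => //; lra.
Qed.

(** With [|G'| <= 6 |g|], [|H| <= 14 |h|] and remainders at most
    [64 t^3 |g|] and [64 t^3 |h|], the splitting
    [G H - G' H' = (G - G') H + G' (H - H')] costs
    [64 * 14 + 6 * 64 = 1280]. *)
Lemma hol_ext_mul_close g h (z : R[i] * R[i]) (t : R) : L2 g -> L2 h ->
  0 <= t <= 2^-1 -> normc z.1 <= t -> normc z.2 <= t ->
  normc (hol_ext g z * hol_ext h z -
    low_part (power_term (fourier_coef g) z) *
    low_part (power_term (fourier_coef h) z)) <=
  1280 * t ^+ 3 * (norm2 g * norm2 h).
Proof.
move=> Lg Lh t012 z1 z2; have /andP[t0 t12] := t012.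
have t3 : 64 * t ^+ 3 <= 8.
  have : t ^+ 3 <= 2^-1 ^+ 3 by rewrite lerXn2r// nnegrE ?invr_ge0.
  by rewrite (_ : 2^-1 ^+ 3 = 8^-1); [lra|field].
have low_le f : L2 f -> normc (low_part (power_term (fourier_coef f) z)) <= 6 * norm2 f.
  move=> Lf; have term_le m n : normc (power_term (fourier_coef f) z m n) <= norm2 f.
    apply: le_trans (power_term_le Lf z1 z2 m n) _.
    by rewrite ler_piMr ?norm2_ge0// exprn_ile1//; lra.
  have add_le (u v : R[i]) (x y : R) : normc u <= x -> normc v <= y ->
      normc (u + v) <= x + y.
    by move=> ux vy; apply: le_trans (normc_triangle _ _) _; exact: lerD.
  rewrite (_ : 6 * _ = norm2 f + (norm2 f + norm2 f) +
    (norm2 f + norm2 f + norm2 f)); last by ring.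
  by rewrite /low_part; do ![exact: term_le | apply: (add_le)].
set G := hol_ext g z; set H := hol_ext h z.
set G' := low_part (power_term (fourier_coef g) z).
set H' := low_part (power_term (fourier_coef h) z).
have GG' : normc (G - G') <= 64 * norm2 g * t ^+ 3 by exact: hol_ext_low.
have HH' : normc (H - H') <= 64 * norm2 h * t ^+ 3 by exact: hol_ext_low.
have G'6 := low_le g Lg; have H'6 := low_le h Lh.
have H14 : normc H <= 14 * norm2 h.
  rewrite -(subrK H' H); apply: le_trans (normc_triangle _ _) _.
  rewrite (_ : 14 * norm2 h = 8 * norm2 h + 6 * norm2 h); last by ring.
  apply: lerD => //; apply: le_trans HH' _; rewrite mulrAC ler_wpM2r ?norm2_ge0//.
rewrite (_ : G * H - G' * H' = (G - G') * H + G' * (H - H')); last by ring.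
apply: le_trans (normc_triangle _ _) _; rewrite !Normc.normcM.
rewrite (_ : 1280 * _ * _ = (64 * norm2 g * t ^+ 3) * (14 * norm2 h) +
  (6 * norm2 g) * (64 * norm2 h * t ^+ 3)); last by ring.
by apply: lerD; apply: ler_pM; rewrite ?normc_ge0.
Qed.

(** The error is at most [(18 + 8 * 1280) t^3 |g| |h|]: the degree four terms of
    [degree2_test_low] and the remainders of [hol_ext_mul_close]. The stated
    constant [2600] is this one divided by [4], rounded up. *)
Lemma degree2_test_mul_le (a b t : R) g h : 0 <= a -> 0 <= b -> a + b <= 1 ->
  2 * a ^+ 2 + b ^+ 2 <= 1 -> L2 g -> L2 h -> 0 <= t <= 2^-1 ->
  complex.Re (degree2_test a b t (fun z : R[i] * R[i] => hol_ext g z * hol_ext h z)) <=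
  4 * t ^+ 2 * (1 + 2600 * t) * (norm2 g * norm2 h).
Proof.
move=> a0 b0 ab1 ab2 Lg Lh t012; have /andP[t0 t12] := t012.
have nab : `|a + b| <= 1 by rewrite ger0_norm ?addr_ge0.
have nab' : `|a - b| <= 1 by rewrite ler_norml; apply/andP; split; lra.
have close (z : R[i] * R[i]) : normc z.1 <= t -> normc z.2 <= t ->
    normc (hol_ext g z * hol_ext h z -
      low_part (power_term (fourier_coef g) z) *
      low_part (power_term (fourier_coef h) z)) <=
    1280 * t ^+ 3 * (norm2 g * norm2 h) by exact: hol_ext_mul_close.
apply: le_trans (degree2_test_close t0 nab nab' close) _.
rewrite (degree2_test_low a b t (fourier_coef g) (fourier_coef h)) ReD !ReZ.
have form_le := degree2_form_le a0 b0 ab1 ab2 Lg Lh.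
have coef_le f m n : L2 f -> normc (fourier_coef f m n) <= norm2 f.
  by move=> Lf; exact: fourier_coef_le.
have sum3_le (u v w : R[i]) (x : R) : normc u <= x -> normc v <= x ->
    normc w <= x -> normc (u + v + w) <= 3 * x.
  move=> ux vx wx; apply: le_trans (normc_triangle _ _) _.
  by have := normc_triangle u v; lra.
have top_le (s : R) (u v w u' v' w' : R[i]) : `|s| <= 1 ->
    normc u <= norm2 g -> normc v <= norm2 g -> normc w <= norm2 g ->
    normc u' <= norm2 h -> normc v' <= norm2 h -> normc w' <= norm2 h ->
    complex.Re (s%:C * ((u + v + w) * (u' + v' + w'))) <=
    9 * (norm2 g * norm2 h).
  move=> s1 hu hv hw hu' hv' hw'; apply: le_trans (ler_norm _) _.
  apply: le_trans (Re_le_normc _) _; rewrite !Normc.normcM normc_real.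
  rewrite -[leRHS]mul1r; apply: ler_pM; rewrite ?mulr_ge0 ?normc_ge0//.
  rewrite (_ : 9 * _ = (3 * norm2 g) * (3 * norm2 h)); last by ring.
  by apply: ler_pM; rewrite ?normc_ge0// sum3_le.
set n := norm2 g * norm2 h; have n0 : 0 <= n by rewrite mulr_ge0 ?norm2_ge0.
rewrite [X in 2 * t ^+ 4 * X]ReD.
have plus_le := top_le _ _ _ _ _ _ _ nab (coef_le g 2%N 0%N Lg)
  (coef_le g 1%N 1%N Lg) (coef_le g 0%N 2%N Lg) (coef_le h 2%N 0%N Lh)
  (coef_le h 1%N 1%N Lh) (coef_le h 0%N 2%N Lh).
have coefN_le f m k : L2 f -> normc (- fourier_coef f m k) <= norm2 f.
  by move=> Lf; rewrite normc_opp; exact: coef_le.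
have minus_le := top_le _ _ _ _ _ _ _ nab' (coef_le g 2%N 0%N Lg)
  (coefN_le g 1%N 1%N Lg) (coef_le g 0%N 2%N Lg) (coef_le h 2%N 0%N Lh)
  (coefN_le h 1%N 1%N Lh) (coef_le h 0%N 2%N Lh).
have t2 : 0 <= t ^+ 2 by exact: sqr_ge0.
have t4 : 2 * t ^+ 4 <= t ^+ 3.
  by rewrite exprS; have : 0 <= t ^+ 3 by [rewrite exprn_ge0|]; nra.
have t40 : 0 <= 2 * t ^+ 4 by rewrite mulr_ge0// exprn_ge0.
apply: (@le_trans _ _ (4 * t ^+ 2 * n + 2 * t ^+ 4 * (9 * n + 9 * n) +
  8 * (1280 * t ^+ 3 * n))).
  rewrite lerD2r; apply: lerD; first by rewrite ler_wpM2l// mulr_ge0.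
  by rewrite ler_wpM2l//; exact: lerD.
have : 2 * t ^+ 4 * (9 * n + 9 * n) <= t ^+ 3 * (9 * n + 9 * n).
  by rewrite ler_wpM2r// addr_ge0// mulr_ge0.
have : 0 <= t ^+ 3 * n by rewrite mulr_ge0// exprn_ge0.
rewrite (_ : 4 * t ^+ 2 * (1 + 2600 * t) * n =
  4 * t ^+ 2 * n + 10400 * (t ^+ 3 * n)); last by ring.
lra.
Qed.

End LowerBound.

(** * The lower bound for the cost of a weak factorization *)

Section LowerBoundCost.
Variable R : realType.
Implicit Types (f g h F : R[i] * R[i] -> R[i]).

Lemma degree2_testD (a b t : R) F F' :
  complex.Re (degree2_test a b t (fun z => F z + F' z)) =
  complex.Re (degree2_test a b t F) + complex.Re (degree2_test a b t F').
Proof. by rewrite !Re_degree2_test !ReD; ring. Qed.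

Lemma degree2_test_cvg (a b t : R) (F_ : nat -> R[i] * R[i] -> R[i]) F :
  (forall z, (`|z.1| <= `|t|%:C) -> (`|z.2| <= `|t|%:C) ->
    (fun N => F_ N z : R[i]^o) @ \oo --> (F z : R[i]^o)) ->
  (fun N => complex.Re (degree2_test a b t (F_ N))) @ \oo -->
  complex.Re (degree2_test a b t F).
Proof.
move=> cF.
have ReF (z : R[i] * R[i]) : `|z.1| <= `|t|%:C -> `|z.2| <= `|t|%:C ->
    (fun N => complex.Re (F_ N z)) @ \oo --> complex.Re (F z).
  by move=> z1 z2; apply: Re_cvg; exact: cF.
have tt : `|t%:C| <= `|t|%:C by rewrite normc_def /= expr0n addr0 sqrtr_sqr.
have tN : `|(- t)%:C| <= `|t|%:C.
  by rewrite normc_def /= expr0n addr0 sqrtr_sqr normrN.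
have t00 : `|0 : R[i]| <= `|t|%:C by rewrite normr0 ler0c.
rewrite Re_degree2_test.
under eq_fun do rewrite Re_degree2_test.
by apply: cvgD; apply: cvgM; try exact: cvg_cst; apply: cvgB;
  [apply: cvgD; exact: ReF | apply: cvgM; [exact: cvg_cst | exact: ReF] |
   apply: cvgD; exact: ReF | apply: cvgM; [exact: cvg_cst | exact: ReF]].
Qed.

(** At each scale [t] only five points of the polydisc are involved, so pointwise
    convergence of the factorization suffices to apply [degree2_test] term by
    term. *)
Lemma weak_factorization_cost_ge (a b alpha : R)
    (g h : nat -> R[i] * R[i] -> R[i]) :
  0 <= a -> 0 <= b -> a + b <= 1 -> 2 * a ^+ 2 + b ^+ 2 <= 1 ->
  weak_factorization (phi alpha) g h ->
  ((2 * a + b * alpha)%:E <= factor_cost g h)%E.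
Proof.
move=> a0 b0 ab1 ab2 [Hg Hh cfin cvg_gh].
have Lg j : L2 (g j) by case: (Hg j).
have Lh j : L2 (h j) by case: (Hh j).
pose n j := norm2 (g j) * norm2 (h j).
have n0 j : 0 <= n j by rewrite mulr_ge0 ?norm2_ge0.
have costE : factor_cost g h = (\sum_(0 <= j <oo) (n j)%:E)%E.
  by rewrite /factor_cost; apply: eq_eseriesr => j _; rewrite !L2norm_norm2.
have cost_ge0 : (0 <= factor_cost g h)%E.
  by rewrite costE; apply: nneseries_ge0 => j _ _; rewrite lee_fin.
have cost_fin : factor_cost g h \is a fin_num by rewrite ge0_fin_numE.
set C := fine (factor_cost g h); have C0 : 0 <= C by exact: fine_ge0.
have partial_le N : \sum_(0 <= j < N) n j <= C.
  rewrite -lee_fin fineK// costE -sumEFin.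
  by apply: nneseries_lim_ge => j _ _; rewrite lee_fin.
(* The value of the constant is irrelevant in the limit t -> 0. *)
have [K K0 test_le] : exists2 K : R, 0 <= K & forall t j, 0 <= t <= 2^-1 ->
    complex.Re (degree2_test a b t
      (fun z : R[i] * R[i] => hol_ext (g j) z * hol_ext (h j) z)) <=
    4 * t ^+ 2 * (1 + K * t) * n j.
  by exists 2600 => [|t j t012]; [exact: ler0n|exact: degree2_test_mul_le].
have value_le t : 0 < t <= 2^-1 -> 2 * a + b * alpha <= (1 + K * t) * C.
  move=> /andP[t0 t12].
  have t012 : 0 <= t <= 2^-1 by rewrite ltW.
  pose S N z := series (fun j => hol_ext (g j) z * hol_ext (h j) z : R[i]^o) N.
  have S_le N : complex.Re (degree2_test a b t (S N)) <=
      4 * t ^+ 2 * (1 + K * t) * \sum_(0 <= j < N) n j.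
    elim: N => [|N ih].
      have S0 z : S 0%N z = 0 by exact: big_geq.
      by rewrite big_geq// mulr0 Re_degree2_test !S0 /=; lra.
    rewrite (_ : S N.+1 = fun z => S N z + hol_ext (g N) z * hol_ext (h N) z).
      rewrite degree2_testD big_nat_recr//= mulrDr; apply: lerD => //.
      exact: test_le.
    by apply/funext => z; rewrite /S /series /= big_nat_recr.
  have Scvg : (fun N => complex.Re (degree2_test a b t (S N))) @ \oo -->
      complex.Re (degree2_test a b t (phi alpha)).
    apply: degree2_test_cvg => z z1 z2; apply: cvg_gh.
    have t1 : `|t|%:C < 1 :> R[i].
      by rewrite -[1]/(1%:C) ltcR gtr0_norm//; lra.
    by split; [exact: le_lt_trans z1 t1 | exact: le_lt_trans z2 t1].
  have t2 : 0 < 4 * t ^+ 2 by rewrite mulr_gt0// exprn_gt0.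
  rewrite -(ler_pM2l t2) -degree2_test_phi.
  apply: (cvgr_to_le Scvg); apply: nearW => N; apply: le_trans (S_le N) _.
  have Kt : 0 <= 4 * t ^+ 2 * (1 + K * t).
    by rewrite mulr_ge0 ?(ltW t2)// addr_ge0// mulr_ge0// ltW.
  by have := ler_wpM2l Kt (partial_le N); rewrite -[leRHS]mulrA.
rewrite -(fineK cost_fin) lee_fin -/C; apply/ler_addgt0Pr => e e0.
(* Small enough for K t C to be at most e. *)
pose t := Num.min 2^-1 (e / (K * C + 1)).
have D0 : 0 < K * C + 1 by rewrite ltr_wpDl// mulr_ge0.
have t0 : 0 < t by rewrite lt_min divr_gt0// invr_gt0 ltr0n.
have t12 : t <= 2^-1 by rewrite ge_min lexx.
apply: le_trans (value_le t _) _; first by rewrite t0.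
rewrite mulrDl mul1r lerD2l.
have : t <= e / (K * C + 1) by rewrite ge_min lexx orbT.
rewrite ler_pdivlMr//; lra.
Qed.

End LowerBoundCost.

(** * Polynomials and their weak factorizations *)

Section UpperBound.
Variable R : realType.
Implicit Types (c d : nat -> nat -> R[i]) (z : R[i] * R[i]).

Definition polynomial_fun N c z : R[i] := square_sum (power_term c z) N.

Lemma polynomial_funE N c z :
  polynomial_fun N c z =
  \sum_(i : 'I_N * 'I_N) c i.1 i.2 * @monomials R N i z.
Proof.
rewrite /polynomial_fun /square_sum pair_big; apply: eq_bigr => i _.
by rewrite /power_term /monomials /monomial mulrA.
Qed.

Definition coefficient_norm N c : R :=
  Num.sqrt (square_sum (fun m n => abs2 (c m n)) N).

Lemma L2_polynomial_fun N c : L2 (polynomial_fun N c).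
Proof.
apply: square_integrable_L2.
have [se _] := orthonormal_monomials R N.
have := square_integrable_comb (fun i : 'I_N * 'I_N => c i.1 i.2) se.
by congr square_integrable; apply/funext => z; rewrite polynomial_funE.
Qed.

Lemma L2norm_polynomial_fun N c :
  L2norm (polynomial_fun N c) = (coefficient_norm N c)%:E.
Proof.
rewrite L2norm_norm2; last exact: L2_polynomial_fun.
congr (Num.sqrt _)%:E; rewrite /square_sum pair_big /=.
rewrite -(parseval (fun i : 'I_N * 'I_N => c i.1 i.2) (orthonormal_monomials R N)).
by congr Rintegral; apply/funext => t; rewrite polynomial_funE.
Qed.

Lemma fourier_coef_polynomial_fun N c m n :
  fourier_coef (polynomial_fun N c) m n =
  if (m < N)%N && (n < N)%N then c m n else 0.
Proof.
have [se _] := orthonormal_monomials R N.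
rewrite fourier_coef_inner.
have -> : polynomial_fun N c =
    fun z => \sum_(i : 'I_N * 'I_N) c i.1 i.2 * @monomials R N i z.
  by apply/funext => z; rewrite polynomial_funE.
rewrite (inner_suml (fun i : 'I_N * 'I_N => c i.1 i.2))//; last first.
  exact: square_integrable_monomial.
under eq_bigr do rewrite inner_monomial.
case: ifP => [/andP[mN nN]|mnN].
  rewrite (bigD1 (Ordinal mN, Ordinal nN))//= !eqxx mulr1 big1 ?addr0//.
  move=> [i j]; rewrite xpair_eqE /= -!val_eqE /= => /negbTE ->.
  by rewrite mulr0.
rewrite big1// => -[i j] _ /=; case: eqP => [im|]; last by rewrite mulr0.
case: eqP => [jn|]; last by rewrite mulr0.
by move: mnN; rewrite -im -jn !ltn_ord.
Qed.

(** The square partial sums of the Fourier series are stationary from [N] on. *)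
Lemma hol_ext_polynomial_fun N c : hol_ext (polynomial_fun N c) = polynomial_fun N c.
Proof.
apply/funext => z; apply: (@cvg_lim R[i]^o); first exact: norm_hausdorff.
apply: cvg_near_cst; exists N => // M /= NM.
transitivity (square_sum (power_term (fourier_coef (polynomial_fun N c)) z) N).
  apply: (square_sum_trunc NM) => m n mn.
  rewrite /power_term fourier_coef_polynomial_fun ifN ?mul0r//.
  by rewrite negb_and -!leqNgt.
apply: eq_bigr => m _; apply: eq_bigr => n _.
by rewrite /power_term fourier_coef_polynomial_fun !ltn_ord.
Qed.

Lemma H2_polynomial_fun N c : H2 (polynomial_fun N c).
Proof.
split; first exact: L2_polynomial_fun.
move=> e e0; exists (\poly_(m < N) \poly_(n < N) c m n).
rewrite (_ : (fun z => _) = polynomial_fun 0 c); last first.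
  apply/funext => z; rewrite [RHS]/polynomial_fun /square_sum big_ord0.
  apply/eqP; rewrite subr_eq0; apply/eqP.
  rewrite /poly2_fun horner_poly horner_sum; apply: eq_bigr => m _.
  rewrite hornerM horner_poly -polyC_exp hornerC mulr_suml.
  by apply: eq_bigr => n _; rewrite /power_term mulrAC.
rewrite L2norm_polynomial_fun lte_fin /coefficient_norm /square_sum big_ord0.
by rewrite sqrtr0.
Qed.

Lemma sum_first_two (V : nmodType) (F : nat -> V) (M : nat) :
  (forall j, F j.+2 = 0) -> (2 <= M)%N ->
  \sum_(0 <= k < M) F k = F 0%N + F 1%N.
Proof.
move=> F0; case: M => [|[|M]]// _.
by rewrite big_nat_recl// big_nat_recl// big1 ?addr0.
Qed.

(** Factors are padded with the zero polynomial, represented as a polynomial of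
    size zero. *)
Lemma Wnorm_le_two_products N c d c' d' (f : R[i] * R[i] -> R[i]) :
  (forall z, polynomial_fun N c z * polynomial_fun N d z +
             polynomial_fun N c' z * polynomial_fun N d' z = f z) ->
  (Wnorm f <= (coefficient_norm N c * coefficient_norm N d +
               coefficient_norm N c' * coefficient_norm N d')%:E)%E.
Proof.
move=> fE; apply: ereal_inf_lbound.
pose u (x y : nat -> nat -> R[i]) (j : nat) : R[i] * R[i] -> R[i] :=
  match j with
  | 0%N => polynomial_fun N x
  | 1%N => polynomial_fun N y
  | _ => polynomial_fun 0 x
  end.
have polyu x y j : exists M e, u x y j = polynomial_fun M e.
  by case: j => [|[|j]]; [exists N, x|exists N, y|exists 0%N, x].
have H2u x y j : H2 (u x y j).
  by have [M [e ->]] := polyu x y j; exact: H2_polynomial_fun.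
have holu x y j : hol_ext (u x y j) = u x y j.
  by have [M [e ->]] := polyu x y j; exact: hol_ext_polynomial_fun.
have L2norm0 x : L2norm (polynomial_fun 0 x) = 0%E.
  by rewrite L2norm_polynomial_fun /coefficient_norm /square_sum big_ord0 sqrtr0.
have costE : factor_cost (u c c') (u d d') =
    (coefficient_norm N c * coefficient_norm N d +
     coefficient_norm N c' * coefficient_norm N d')%:E.
  rewrite /factor_cost (@nneseries_split _ _ 0 2); last first.
    by move=> k _; apply: mule_ge0; exact: Lnorm_ge0.
  rewrite add0n eseries0 ?adde0; last first.
    by move=> [|[|j]]// _ _; rewrite /u !L2norm0 mule0.
  by rewrite !big_nat_recl// big_geq// adde0 /u !L2norm_polynomial_fun.
exists (u c c'), (u d d'); split=> //; split=> //.
  by rewrite costE ltry.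
move=> z _; apply: cvg_near_cst; exists 2%N => // M /= M2.
rewrite -fE -[polynomial_fun N c]/(u c c' 0%N) -[polynomial_fun N d]/(u d d' 0%N).
rewrite -[polynomial_fun N c']/(u c c' 1%N) -[polynomial_fun N d']/(u d d' 1%N).
rewrite -(holu c c' 0%N) -(holu c c' 1%N) -(holu d d' 0%N) -(holu d d' 1%N).
apply: (sum_first_two
  (F := fun j => hol_ext (u c c' j) z * hol_ext (u d d' j) z)) => // j.
by rewrite !holu /u /polynomial_fun /square_sum big_ord0 mul0r.
Qed.

Definition quadratic_coef (e p q x y w : R) (m n : nat) : R[i] :=
  match m, n with
  | 0, 0 => e%:C
  | 1, 0 => p%:C
  | 0, 1 => q%:C
  | 2, 0 => x%:C
  | 1, 1 => y%:C
  | 0, 2 => w%:C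
  | _, _ => 0%R
  end%N.

Lemma quadratic_funE (e p q x y w : R) z :
  polynomial_fun 3 (quadratic_coef e p q x y w) z =
  e%:C + p%:C * z.1 + q%:C * z.2 + x%:C * z.1 ^+ 2 + y%:C * z.1 * z.2 +
  w%:C * z.2 ^+ 2.
Proof.
rewrite /polynomial_fun /square_sum !big_ord_recl !big_ord0 /power_term /=.
by rewrite /bump /= !mul0r !addr0 expr0 !expr1 !mulr1; ring.
Qed.

Lemma coefficient_norm_quadratic (e p q x y w : R) :
  coefficient_norm 3 (quadratic_coef e p q x y w) =
  Num.sqrt (e ^+ 2 + p ^+ 2 + q ^+ 2 + x ^+ 2 + y ^+ 2 + w ^+ 2).
Proof.
rewrite /coefficient_norm; congr Num.sqrt.
rewrite /square_sum !big_ord_recl !big_ord0 /bump /abs2 /= !expr0n /=.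
by ring.
Qed.

End UpperBound.

(** * The norm of phi_alpha *)

Lemma Wnorm_phi_ge (R : realType) (a b alpha v : R) :
  0 <= a -> 0 <= b -> a + b <= 1 -> 2 * a ^+ 2 + b ^+ 2 <= 1 ->
  2 * a + b * alpha = v -> (v%:E <= Wnorm (phi alpha))%E.
Proof.
move=> a0 b0 ab1 ab2 <-; apply: le_ereal_inf_tmp => _ [g [h [gh ->]]].
exact: weak_factorization_cost_ge gh.
Qed.

(** The convex combination [s phi_v * 1 + u (z1 + z2) * (z1 + z2)]. *)
Lemma Wnorm_phi_le (R : realType) (s u v alpha val : R) :
  0 <= s -> 0 <= u -> s + u = 1 -> s * v + u * 2 = alpha ->
  s * Num.sqrt (2 + v ^+ 2) + u * 2 = val ->
  (Wnorm (phi alpha) <= val%:E)%E.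
Proof.
move=> s0 u0 su sv <-.
have := @Wnorm_le_two_products R 3
  (quadratic_coef 0 0 0 s (s * v) s) (quadratic_coef 1 0 0 0 0 0)
  (quadratic_coef 0 u u 0 0 0) (quadratic_coef 0 1 1 0 0 0) (phi alpha).
rewrite !coefficient_norm_quadratic expr0n expr1n /= !addr0 !add0r sqrtr1 mulr1.
rewrite (_ : s ^+ 2 + (s * v) ^+ 2 + s ^+ 2 = s ^+ 2 * (2 + v ^+ 2)); last by ring.
rewrite (_ : u ^+ 2 + u ^+ 2 = u ^+ 2 * 2); last by ring.
rewrite (sqrtrM _ (sqr_ge0 s)) (sqrtrM _ (sqr_ge0 u)) !sqrtr_sqr !ger0_norm//.
rewrite -[u * _ * _]mulrA.
rewrite -[1 + 1]/(2 : R) -expr2 sqr_sqrtr//; apply.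
move=> z; rewrite !quadratic_funE /phi -sv.
have -> : (s * v + u * 2)%:C = s%:C * v%:C + u%:C * 2 :> R[i].
  by rewrite (rmorphD _ (s * v)) (rmorphM _ s) (rmorphM _ u) rmorph_nat.
have -> : u%:C = 1 - s%:C :> R[i].
  by rewrite (_ : u = 1 - s) ?(rmorphB _ 1) ?rmorph1// -su addrAC subrr add0r.
rewrite (rmorphM _ s) /=; ring.
Qed.

(** [phi_alpha = (z1 + z2) * (z1 + z2) + (alpha - 2) z1 * z2], at cost
    [2 + (alpha - 2)]. *)
Lemma Wnorm_phi_le_large (R : realType) (alpha : R) : 2 <= alpha ->
  (Wnorm (phi alpha) <= alpha%:E)%E.
Proof.
move=> a2.
have := @Wnorm_le_two_products R 3
  (quadratic_coef 0 1 1 0 0 0) (quadratic_coef 0 1 1 0 0 0)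
  (quadratic_coef 0 (alpha - 2) 0 0 0 0) (quadratic_coef 0 0 1 0 0 0) (phi alpha).
rewrite !coefficient_norm_quadratic expr0n expr1n /= !addr0 !add0r sqrtr1 mulr1.
rewrite -[1 + 1]/(2 : R) -expr2 sqr_sqrtr// sqrtr_sqr ger0_norm ?subr_ge0//.
rewrite [2 + _]addrC subrK; apply => z.
rewrite !quadratic_funE /phi (rmorphB _ alpha) rmorph_nat /=.
ring.
Qed.

Unset Implicit Arguments.

Theorem theorem11 (R : realType) (alpha : R) (halpha : 0 <= alpha) :
  Wnorm (phi alpha) =
    (if alpha <= 1 / 2 then Num.sqrt (2 + alpha ^+ 2)
     else if alpha <= 2 then (4 + alpha) / 3
     else alpha)%:E.
Proof.
apply/eqP; rewrite eq_le; apply/andP.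
have [a12|a12] := leP alpha (1 / 2).
  (* The row (1, alpha, 1) scaled to norm one. *)
  have D0 : 0 < 2 + alpha ^+ 2 by rewrite ltr_wpDr ?sqr_ge0.
  set r := Num.sqrt (2 + alpha ^+ 2).
  have r0 : 0 < r by rewrite sqrtr_gt0.
  have r2 : r ^+ 2 = 2 + alpha ^+ 2 by rewrite sqr_sqrtr// ltW.
  split.
    by apply: (@Wnorm_phi_le _ 1 0 alpha) => //; rewrite ?addr0 ?mul0r ?mul1r ?addr0.
  apply: (@Wnorm_phi_ge _ (1 / r) (alpha / r)).
  - by rewrite divr_ge0// ltW.
  - by rewrite divr_ge0// ltW.
  - rewrite -mulrDl ler_pdivrMr// mul1r -(@ler_pXn2r _ 2)// ?nnegrE ?addr_ge0//.
      by rewrite r2 sqrrD; lra.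
    exact: ltW.
  - by rewrite !expr_div_n r2 le_eqVlt; apply/orP; left; apply/eqP; field; rewrite gt_eqF.
  - rewrite (_ : 2 * (1 / r) + alpha / r * alpha = (2 + alpha ^+ 2) / r).
      by rewrite -r2 expr2 mulfK// gt_eqF.
    by field; rewrite gt_eqF.
have [a2|a2] := leP alpha 2; split.
(* The weights solve s / 2 + 2 u = alpha with s + u = 1. *)
- apply: (@Wnorm_phi_le _ ((4 - 2 * alpha) / 3) ((2 * alpha - 1) / 3) (1 / 2)).
  + lra.
  + lra.
  + lra.
  + lra.
  + rewrite (_ : 2 + (1 / 2) ^+ 2 = (3 / 2) ^+ 2); last by field.
    by rewrite sqrtr_sqr ger0_norm; [field|lra].
(* The solution of 2 a^2 + b^2 = a + b = 1 with a nonzero. *)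
- by apply: (@Wnorm_phi_ge _ (2 / 3) (1 / 3)); lra.
- by apply: Wnorm_phi_le_large; exact: ltW.
- by apply: (@Wnorm_phi_ge _ 0 1); lra.
Qed.
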